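(* Let $(X_n)$ be a countable (finite or countably infinite) family of metric spaces and $X=\prod_n X_n$ with the product topology. For every $n$, let $\phi_n : B^+_{b,n}\to\mathbb{R}_+$ be a mapping such that for all $m,\varepsilon\in\mathbb{R}_+\setminus\{0\}$ there exists a compact set $K_n\subseteq X_n$ with $\phi_n(m 1_{K_n^c})\le\varepsilon$. Let $\phi : B_b\to\mathbb{R}$ be an increasing convex functional satisfying $\phi(f)\le\sum_n\phi_n(g_n)$ for all $f\in B_b$ and $g_n\in B^+_{b,n}$ such that $f\le\oplus g$. Then the lower level sets $$\Lambda_a:=\{\mu\in ca^+:\phi^*_{C_b}(\mu)\le a\},\quad a\in\mathbb{R},$$ are sequentially compact, and the following are equivalent: (i) $\phi(f)=\max_{\mu\in ca^+}(\langle f,\mu\rangle-\phi^*_{C_b}(\mu))$ for all $f\in U_b$ (with the maximum attained); (ii) $\phi(f_j)\downarrow\phi(f)$ for all $f\in U_b$ and every sequence $(f_j)$ in $C_b$ satisfying $f_j\downarrow f$; (iii) $\phi(f)=\inf_{g\in C_b,\,g\ge f}\phi(g)$ for all $f\in U_b$; (iv) $\phi^*_{C_b}(\mu)=\phi^*_{U_b}(\mu):=\sup_{f\in U_b}(\langle f,\mu\rangle-\phi(f))$ for all $\mu\in ca^+$.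
   Context: $B_b$ is the space of all bounded Borel measurable functions $f:X\to\mathbb{R}$; $C_b$ and $U_b$ are the subsets of bounded continuous, respectively bounded upper semicontinuous, functions. $B^+_{b,n}$ is the set of all bounded Borel measurable functions $g:X_n\to\mathbb{R}_+=[0,\infty)$. $ca^+$ is the set of all finite (nonnegative) Borel measures on $X$. $\langle f,\mu\rangle:=\int f\,d\mu$. For a family $g=(g_n)$ with $g_n\in B^+_{b,n}$, $\oplus g:=\sum_n g_n\circ\pi_n : X\to\mathbb{R}_+\cup\{+\infty\}$, where $\pi_n:X\to X_n$ is the projection on the $n$-th coordinate. Inequalities between functions are pointwise; ''increasing'' means $\phi(f)\ge\phi(g)$ whenever $f\ge g$. The sum $\sum_n\phi_n(g_n)$ takes values in $[0,+\infty]$. The convex conjugate $\phi^*_{C_b}:ca^+\to\mathbb{R}\cup\{+\infty\}$ is $\phi^*_{C_b}(\mu):=\sup_{f\in C_b}(\langle f,\mu\rangle-\phi(f))$. The notation $f_j\downarrow f$ means that $(f_j)$ is a decreasing sequence of functions converging pointwise to $f$ (and analogously for real numbers). A subset $\Lambda\subseteq ca^+$ is called sequentially compact if every sequence in $\Lambda$ has a subsequence converging to some $\mu\in\Lambda$ with respect to $\sigma(ca^+,C_b)$, the coarsest topology making all maps $\mu\mapsto\langle f,\mu\rangle$, $f\in C_b$, continuous. *)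

(* Defs.v *)
From HB Require Import structures.
From mathcomp Require Import all_boot all_order all_algebra.
From mathcomp Require Import all_classical all_reals all_analysis.

Set Implicit Arguments.
Unset Strict Implicit.
Unset Printing Implicit Defensive.

Import Order.TTheory GRing.Theory Num.Theory.
Import numFieldNormedType.Exports.

Local Open Scope classical_set_scope.
Local Open Scope ring_scope.

(* A measurableType must be pointed, so the metric spaces carry a point. *)
#[short(type="pmetricType")]
HB.structure Definition PointedMetric (K : numDomainType) :=
  {T of Metric K T & isPointed T}.

HB.instance Definition _ (I : Type) (T : I -> ptopologicalType) :=
  Pointed.on (prod_topology T).

Notation borel T := (g_sigma_algebraType (@open T)).

Section function_spaces.
Context {R : realType}.

Section spaces.
Context {T : ptopologicalType}.
Implicit Types f : T -> R.

Definition upper_semicontinuous f :=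
  forall x a, f x < a -> \forall y \near x, f y < a.

Definition Bb : set (T -> R) :=
  [set f : T -> R | bounded_fun f /\ measurable_fun [set: borel T] f].

Definition Bb_plus : set (T -> R) :=
  [set g : T -> R | Bb g /\ forall x, 0 <= g x].

Definition Cb : set (T -> R) := [set f : T -> R | bounded_fun f /\ continuous f].

Definition Ub : set (T -> R) :=
  [set f : T -> R | bounded_fun f /\ upper_semicontinuous f].

End spaces.

Definition ca_plus (T : ptopologicalType) :=
  {finite_measure set (borel T) -> \bar R}.

Definition pairing (T : ptopologicalType) (f : T -> R) (mu : ca_plus T) : R :=
  \int[mu]_(x in [set: borel T]) f x.

(* sigma(ca^+, Cb): the supremum of the initial topologies of the maps
   mu |-> <f, mu> for f in Cb. *)
Definition sigma_ca_Cb (T : ptopologicalType) :=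
  sup_topology (fun f : {f : T -> R | Cb f} =>
    Topological.class (initial_topology
      (fun mu : {classic ca_plus T} => pairing (sval f) mu : R))).

HB.instance Definition _ (T : ptopologicalType) :=
  Topological.on (sigma_ca_Cb T).

Definition conjugate (T : ptopologicalType) (D : set (T -> R))
    (phi : (T -> R) -> R) (mu : ca_plus T) : \bar R :=
  ereal_sup [set (pairing f mu - phi f)%:E | f in D].

Definition oplus (I : choiceType) (X : I -> Type) (g : forall i, X i -> R)
    (x : prod_topology X) : \bar R :=
  \esum_(i in [set: I]) (g i (x i))%:E.

Definition decreases_to (u : nat -> R) (l : R) :=
  nonincreasing_seq u /\ u @ \oo --> l.

End function_spaces.

Definition sequentially_compact (S : topologicalType) (A : set S) :=
  forall u : nat -> S, (forall n, A (u n)) ->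
    exists2 s : nat -> nat, increasing_seq s &
      exists2 l, A l & (u \o s) @ \oo --> l.

Definition is_max d (T : porderType d) (A : set T) (y : T) :=
  A y /\ ubound A y.

(* Main.v *)
Require Import Defs.
From HB Require Import structures.
From mathcomp Require Import all_boot all_order all_algebra.
From mathcomp Require Import all_classical all_reals all_analysis.
From mathcomp Require Import measurable_realfun lra ring.

Set Implicit Arguments.
Unset Strict Implicit.
Unset Printing Implicit Defensive.

Import Order.TTheory GRing.Theory Num.Theory.
Import numFieldNormedType.Exports.

Local Open Scope classical_set_scope.
Local Open Scope ring_scope.

(** The whole argument rests on tightness. For [mu] with conjugate at most [a],
    testing against [m h], where [h] is continuous with values in [0, 1] and
    vanishes on the compact box [K], gives

      m <h, mu> <= a + phi (m 1_(~K)),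

    and the bound by the marginal functionals makes the last term small for a
    suitable [K], a product of compact sets chosen with a geometric series of
    budgets ([product_tight]). The same estimate holds for every positive linear
    functional on [Cb] below [a + phi] ([level_tight]). Such a functional is thus
    tight, and a tight functional is the integral against a finite Borel measure:
    the outer measure of a set is the least cost of an increasing sequence of
    continuous functions that covers it, open sets are Caratheodory measurable,
    and tightness gives the right total mass ([riesz_pairing]).

    Two consequences follow. A Hahn-Banach subgradient of [phi] at [f] in [Cb] is
    a measure, so the maximum over measures is attained there ([Cb_maximizer]).
    And a sequence of measures in a level set has a limit along an ultrafilter,
    first as a functional and therefore as a measure; a countable family of
    continuous functions that approximates all of [Cb] on the compact sets
    selects an ordinary subsequence with the same limit ([level_subsequence]).

    For [f] upper semicontinuous and [f_ j] in [Cb] decreasing to [f], maximizers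
    for [f_ j] stay in one level set; a limit point [mu] satisfies

      <f, mu> - conjugate Cb phi mu >= lim phi (f_ j) >= phi f

    ([decreasing_limit_maximizer]), from which the equivalences are read off. All
    this happens on a pseudometric space, where every bounded upper semicontinuous
    function is such a decreasing limit ([Ub_approx]); a countable product of
    metric spaces is one. *)

(** * Minimal sublinear functionals and subgradients *)

Section hahn_banach.
Context {R : realType} {V : lmodType R}.
Implicit Types (C : set V) (p q : V -> R).

Definition subspace_set C :=
  C 0 /\ forall (a : R) x y, C x -> C y -> C (a *: x + y).

Definition sublinear_on C p :=
  (forall x y, C x -> C y -> p (x + y) <= p x + p y) /\
  (forall (t : R) x, 0 < t -> C x -> p (t *: x) = t * p x).

Definition linear_on C p :=
  forall (a : R) x y, C x -> C y -> p (a *: x + y) = a * p x + p y.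

Section subspace.
Variables (C : set V) (subC : subspace_set C).

Lemma subspaceD x y : C x -> C y -> C (x + y).
Proof. by move=> Cx Cy; rewrite -[x]scale1r; apply: subC.2. Qed.

Lemma subspaceZ (a : R) x : C x -> C (a *: x).
Proof. by move=> Cx; rewrite -[_ *: _]addr0; apply: subC.2 => //; exact: subC.1. Qed.

Lemma subspaceN x : C x -> C (- x).
Proof. by move=> Cx; rewrite -scaleN1r; exact: subspaceZ. Qed.

Lemma sublinear0 p : sublinear_on C p -> p 0 = 0.
Proof.
by case=> _ /(_ 2 0 (ltr0Sn R 1) subC.1); rewrite scaler0; lra.
Qed.

Lemma sublinear_opp_ge p x : sublinear_on C p -> C x -> - p (- x) <= p x.
Proof.
move=> sp Cx; have := sp.1 _ _ Cx (subspaceN Cx).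
by rewrite subrr sublinear0//; lra.
Qed.

(** The largest sublinear functional below [q] that grows affinely, with slope
    [q v], along the ray in direction [v]. *)
Let tilt q v x := inf [set q (x + t *: v) - t * q v | t in [set t : R | 0 <= t]].

Let tilt_lb q v x : sublinear_on C q -> C v -> C x ->
  lbound [set q (x + t *: v) - t * q v | t in [set t : R | 0 <= t]] (- q (- x)).
Proof.
move=> sq Cv Cx _ [t /= t0 <-].
have Ctv := subspaceZ t Cv.
have := sq.1 _ _ (subspaceD Cx Ctv) (subspaceN Cx).
rewrite addrAC subrr add0r.
suff -> : q (t *: v) = t * q v by lra.
move: t0; rewrite le_eqVlt => /predU1P[<-|t0]; last by rewrite sq.2.
by rewrite scale0r mul0r (sublinear0 sq).
Qed.

Let tilt_le q v x t : sublinear_on C q -> C v -> C x -> 0 <= t ->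
  tilt q v x <= q (x + t *: v) - t * q v.
Proof.
move=> sq Cv Cx t0; apply: ge_inf; last by exists t.
by exists (- q (- x)); exact: tilt_lb.
Qed.

Let tilt_ge q v x r :
  (forall t, 0 <= t -> r <= q (x + t *: v) - t * q v) -> r <= tilt q v x.
Proof.
move=> h; apply: lb_le_inf; first by exists (q (x + 0 *: v) - 0 * q v), 0 => /=.
by move=> _ [t /= t0 <-]; exact: h.
Qed.

Let tilt_sublinear q v : sublinear_on C q -> C v -> sublinear_on C (tilt q v).
Proof.
move=> sq Cv; split.
  move=> x y Cx Cy; rewrite -lerBlDr; apply: tilt_ge => t t0.
  rewrite lerBlDr -lerBlDl; apply: tilt_ge => s s0.
  have Cxt := subspaceD Cx (subspaceZ t Cv).
  have Cys := subspaceD Cy (subspaceZ s Cv).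
  have := sq.1 _ _ Cxt Cys.
  have := @tilt_le q v (x + y) (t + s) sq Cv (subspaceD Cx Cy) (addr_ge0 t0 s0).
  by rewrite scalerDl addrACA; lra.
have half (t : R) x : 0 < t -> C x -> t * tilt q v x <= tilt q v (t *: x).
  move=> t0 Cx; apply: tilt_ge => s s0.
  rewrite mulrC -ler_pdivlMr//.
  have st : 0 <= s / t by rewrite divr_ge0// ltW.
  apply: (le_trans (tilt_le sq Cv Cx st)).
  have -> : t *: x + s *: v = t *: (x + (s / t) *: v).
    by rewrite scalerDr scalerA [t * _]mulrC divfK ?gt_eqF.
  rewrite sq.2//; last exact/subspaceD/subspaceZ.
  suff -> : (t * q (x + (s / t) *: v) - s * q v) / t =
            q (x + (s / t) *: v) - (s / t) * q v by [].
  by field; rewrite gt_eqF.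
move=> t x t0 Cx; apply/eqP; rewrite eq_le half// andbT.
have it0 : 0 < t^-1 by rewrite invr_gt0.
have := half _ _ it0 (subspaceZ t Cx).
by rewrite scalerA mulVf ?gt_eqF// scale1r mulrC ler_pdivrMr// mulrC.
Qed.

(** Hahn-Banach without extending functionals from subspaces: Zorn's lemma gives
    a minimal sublinear functional below [p], and a minimal one is additive
    because it coincides with each of its tilts. *)
Lemma hahn_banach p : sublinear_on C p ->
  exists2 q, linear_on C q & forall x, C x -> q x <= p x.
Proof.
move=> sp.
pose S := {q : V -> R | sublinear_on C q /\ forall x, C x -> q x <= p x}.
pose below (q1 q2 : S) := `[< forall x, C x -> sval q2 x <= sval q1 x >].
have p0 : S by exists p.
have [||A totA|[q [sq qp]] qmin] := @ZL_preorder S p0 below.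
- by move=> t; apply/asboolP.
- move=> r s t /asboolP rs /asboolP st; apply/asboolP => x Cx.
  exact: le_trans (st _ Cx) (rs _ Cx).
- have [[q0 Aq0]|/forallNP A0] := pselect (exists s, A s); last first.
    by exists p0 => s /A0.
  pose m x := inf [set sval s x | s in A].
  have lbm x : C x -> lbound [set sval s x | s in A] (- p (- x)).
    move=> Cx _ [[q [sq qp]] /= Aq <-].
    have := qp _ (subspaceN Cx).
    by have := sublinear_opp_ge sq Cx; lra.
  have m_le x s : C x -> A s -> m x <= sval s x.
    by move=> Cx As; apply: ge_inf; [exists (- p (- x)); exact: lbm|exists s].
  have m_ge x r : (forall s, A s -> r <= sval s x) -> r <= m x.
    move=> h; apply: lb_le_inf; first by exists (sval q0 x), q0.
    by move=> _ [s As <-]; exact: h.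
  have sm : sublinear_on C m.
    split=> [x y Cx Cy|].
      rewrite -lerBlDr; apply/m_ge => s1 As1.
      rewrite lerBlDr -lerBlDl; apply/m_ge => s2 As2.
      have [/asboolP q12|/asboolP q21] := totA _ _ As1 As2.
        have := m_le _ _ (subspaceD Cx Cy) As2.
        have := (svalP s2).1.1 x y Cx Cy.
        by have := q12 _ Cx; lra.
      have := m_le _ _ (subspaceD Cx Cy) As1.
      have := (svalP s1).1.1 x y Cx Cy.
      by have := q21 _ Cy; lra.
    move=> t x t0 Cx; apply/eqP; rewrite eq_le; apply/andP; split.
      rewrite mulrC -ler_pdivrMr//; apply/m_ge => s As.
      rewrite ler_pdivrMr// mulrC -(svalP s).1.2//.
      exact: (m_le _ _ (subspaceZ _ Cx)).
    apply/m_ge => s As; rewrite (svalP s).1.2// ler_pM2l//.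
    exact: m_le.
  have mp x : C x -> m x <= p x.
    by move=> Cx; apply: le_trans (m_le _ _ Cx Aq0) ((svalP q0).2 _ Cx).
  exists (exist _ m (conj sm mp)) => s As; apply/asboolP => x Cx /=.
  exact: m_le.
have qD x v : C x -> C v -> q (x + v) = q x + q v.
  move=> Cx Cv; apply/eqP; rewrite eq_le sq.1//=.
  have tq y : C y -> tilt q v y <= q y.
    by move=> Cy; have := tilt_le sq Cv Cy (lexx 0); rewrite scale0r mul0r addr0 subr0.
  pose qv : S := exist _ (tilt q v) (conj (tilt_sublinear sq Cv)
    (fun y Cy => le_trans (tq y Cy) (qp y Cy))).
  have /asboolP/(_ x Cx)/= qt : below qv (exist _ q (conj sq qp)).
    by apply: qmin; apply/asboolP => y /tq.
  by have := tilt_le sq Cv Cx ler01; rewrite scale1r mul1r; lra.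
exists q => // a x y Cx Cy; rewrite qD//; last exact: subspaceZ.
have qN z : C z -> q (- z) = - q z.
  move=> Cz; have := qD _ _ Cz (subspaceN Cz).
  by rewrite subrr (sublinear0 sq); lra.
congr (_ + _); have [a0|a0|->] := ltgtP a 0; last 1 first.
- by rewrite scale0r mul0r (sublinear0 sq).
- rewrite -[a]opprK scaleNr qN; last exact: subspaceZ.
  by rewrite sq.2 ?oppr_gt0// !mulNr !opprK.
- exact: sq.2.
Qed.

(** The one-sided directional derivative of [phi] at [f] is finite and sublinear
    by convexity, and a linear functional below it is a subgradient. *)
Lemma convex_subgradient (phi : V -> R) f : C f ->
  (forall (t : R) x y, 0 <= t <= 1 -> C x -> C y ->
    phi (t *: x + (1 - t) *: y) <= t * phi x + (1 - t) * phi y) ->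
  exists2 q, linear_on C q & forall h, C h -> q h <= phi (f + h) - phi f.
Proof.
move=> Cf cvx.
pose quot h (t : R) := (phi (f + t *: h) - phi f) / t.
pose p h := inf [set quot h t | t in [set t : R | 0 < t]].
have Cfh t h : C h -> C (f + t *: h).
  by move=> Ch; exact/subspaceD/subspaceZ.
have lbp h : C h -> lbound [set quot h t | t in [set t : R | 0 < t]]
    (phi f - phi (f - h)).
  move=> Ch _ [t /= t0 <-]; rewrite /quot ler_pdivlMr//.
  pose s := (1 + t)^-1.
  have t1 : 0 < 1 + t by lra.
  have s01 : 0 <= s <= 1.
    by rewrite /s invr_ge0 (ltW t1)/= invf_le1//; lra.
  have sE : 1 - s = t * s by rewrite /s; field; rewrite gt_eqF.
  have := cvx s _ _ s01 (Cfh t _ Ch) (subspaceD Cf (subspaceN Ch)).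
  have -> : s *: (f + t *: h) + (1 - s) *: (f - h) = f.
    rewrite !scalerDr addrACA -scalerDl subrKC scale1r.
    by rewrite scalerA scalerN sE [t * s]mulrC subrr addr0.
  have hs : phi f = s * phi f + s * t * phi f.
    by rewrite -mulrDl -[X in X + _]mulr1 -mulrDr mulVf ?mul1r// gt_eqF.
  rewrite sE => hc; rewrite -(@ler_pM2l _ s) ?invr_gt0//.
  lra.
have p_le h t : C h -> 0 < t -> p h <= quot h t.
  move=> Ch t0; apply: ge_inf; last by exists t.
  by exists (phi f - phi (f - h)); exact: lbp.
have p_ge h r : (forall t, 0 < t -> r <= quot h t) -> r <= p h.
  move=> hr; apply: lb_le_inf; first by exists (quot h 1), 1 => /=.
  by move=> _ [t /= t0 <-]; exact: hr.
have sp : sublinear_on C p.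
  split=> [x y Cx Cy|].
    rewrite -lerBlDr; apply/p_ge => t t0.
    rewrite lerBlDr -lerBlDl; apply/p_ge => s s0.
    (* the step r below makes f + r (x + y) a convex combination of f + t x
       and f + s y *)
    pose u := s / (t + s); pose r := t * u.
    have ts0 : 0 < t + s by rewrite addr_gt0.
    have u01 : 0 <= u <= 1.
      by rewrite /u divr_ge0 ?(ltW s0, ltW ts0)//= ler_pdivrMr//; lra.
    have uE : (1 - u) * s = r by rewrite /r /u; field; rewrite gt_eqF.
    have r0 : 0 < r by rewrite /r /u !mulr_gt0 ?invr_gt0.
    rewrite lerBlDl; apply: (le_trans (p_le _ _ (subspaceD Cx Cy) r0)).
    have := cvx u _ _ u01 (Cfh t _ Cx) (Cfh s _ Cy).
    have -> : u *: (f + t *: x) + (1 - u) *: (f + s *: y) = f + r *: (x + y).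
      rewrite !scalerDr addrACA -scalerDl subrKC scale1r !scalerA.
      by rewrite uE [u * t]mulrC.
    rewrite /quot ler_pdivrMr// => hc.
    set A := phi (f + t *: x) in hc *; set B := phi (f + s *: y) in hc *.
    have -> : ((A - phi f) / t + (B - phi f) / s) * r =
              u * (A - phi f) + (1 - u) * (B - phi f).
      by rewrite /r /u; field; rewrite !gt_eqF.
    lra.
  have half (t : R) x : 0 < t -> C x -> t * p x <= p (t *: x).
    move=> t0 Cx; apply/p_ge => s s0.
    apply: le_trans (_ : t * quot x (s * t) <= _).
      by rewrite ler_pM2l// p_le// mulr_gt0.
    rewrite /quot scalerA le_eqVlt; apply/orP; left; apply/eqP.
    by field; rewrite !gt_eqF.
  move=> t x t0 Cx; apply/eqP; rewrite eq_le half// andbT.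
  have it0 : 0 < t^-1 by rewrite invr_gt0.
  have := half _ _ it0 (subspaceZ t Cx).
  by rewrite scalerA mulVf ?gt_eqF// scale1r mulrC ler_pdivrMr// mulrC.
have [q lq qp] := hahn_banach sp.
exists q => // h Ch; apply: (le_trans (qp _ Ch)).
by have := p_le h 1 Ch ltr01; rewrite /quot scale1r divr1.
Qed.

End subspace.
End hahn_banach.

(** * Bounded functions and their integrals *)

Lemma decreases_to_ge {R : realType} (u : nat -> R) (l : R) n :
  decreases_to u l -> l <= u n.
Proof.
move=> [dec cv]; rewrite -(cvg_lim (@Rhausdorff R) cv).
by apply: nonincreasing_cvgn_ge => //; apply/cvg_ex; exists l.
Qed.

Section bounded_functions.
Context {R : realType} {T : ptopologicalType}.
Implicit Types f g : T -> R.

Lemma bounded_existsP f : bounded_fun f <-> exists M, forall x, `|f x| <= M.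
Proof.
have PF : ProperFilter (globally [set: T]) by exact: (@globally_properfilter _ _ point).
split=> [/ex_bound[M fM]|[M fM]]; first by exists M => x; exact: fM.
by apply/ex_bound; exists M => x _; exact: fM.
Qed.

Lemma Cb_cst (c : R) : Cb (fun _ : T => c).
Proof.
split; last by move=> x; exact: cvg_cst.
by apply/bounded_existsP; exists `|c|.
Qed.

Lemma CbD f g : Cb f -> Cb g -> Cb (fun x => f x + g x).
Proof.
move=> [/bounded_existsP[M fM] cf] [/bounded_existsP[N gN] cg].
split; last by move=> x; exact: cvgD (cf x) (cg x).
by apply/bounded_existsP; exists (M + N) => x; rewrite (le_trans (ler_normD _ _))// lerD.
Qed.

Lemma CbZ (a : R) f : Cb f -> Cb (fun x => a * f x).
Proof.
move=> [/bounded_existsP[M fM] cf].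
split; last by move=> x; apply: cvgM (cf x); exact: cvg_cst.
by apply/bounded_existsP; exists (`|a| * M) => x; rewrite normrM ler_wpM2l.
Qed.

Lemma CbN f : Cb f -> Cb (fun x => - f x).
Proof.
by move=> /(CbZ (-1)); congr Cb; apply/funext => x; rewrite mulN1r.
Qed.

Lemma CbB f g : Cb f -> Cb g -> Cb (fun x => f x - g x).
Proof. by move=> Cf /CbN; exact: CbD. Qed.

Lemma Cb_norm f : Cb f -> Cb (fun x => `|f x|).
Proof.
move=> [/bounded_existsP[M fM] cf].
split; last by move=> x; apply: cvg_norm; exact: cf.
by apply/bounded_existsP; exists M => x; rewrite normr_id.
Qed.

Lemma Cb_max f g : Cb f -> Cb g -> Cb (fun x => Num.max (f x) (g x)).
Proof.
move=> Cf Cg.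
rewrite (_ : (fun _ => _) = (fun x => 2^-1 * (f x + g x + `|f x - g x|))).
  by apply: CbZ; apply: CbD; [exact: CbD|exact/Cb_norm/CbB].
by apply/funext => x; rewrite maxr_absE mulrC.
Qed.

Lemma Cb_min f g : Cb f -> Cb g -> Cb (fun x => Num.min (f x) (g x)).
Proof.
move=> Cf Cg; rewrite (_ : (fun _ => _) = fun x => - Num.max (- f x) (- g x)).
  by apply/CbN/Cb_max; exact: CbN.
by apply/funext => x; rewrite oppr_max !opprK.
Qed.

Lemma Cb_sum (I : Type) (s : seq I) (F : I -> T -> R) :
  (forall i, Cb (F i)) -> Cb (fun x => \sum_(i <- s) F i x).
Proof.
move=> CF; elim: s => [|i s ih].
  by under eq_fun do rewrite big_nil; exact: Cb_cst.
by under eq_fun do rewrite big_cons; exact: CbD.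
Qed.

Lemma Cb_bigmax (I : Type) (s : seq I) (F : I -> T -> R) :
  (forall i, Cb (F i)) -> Cb (fun x => \big[Num.max/0]_(i <- s) F i x).
Proof.
move=> CF; elim: s => [|i s ih].
  by under eq_fun do rewrite big_nil; exact: Cb_cst.
by under eq_fun do rewrite big_cons; exact: Cb_max.
Qed.

Lemma Cb_Ub f : Cb f -> Ub f.
Proof.
move=> [bf cf]; split=> // x a fxa.
by have /(_ _ (lt_nbhsl fxa)) := cf x.
Qed.

Lemma Ub_Bb f : Ub f -> Bb f.
Proof.
move=> [bf uf]; split=> //.
apply: (measurability _ (RGenInftyO.measurableE R)) => //= _ [_ [a ->] <-].
have -> : f @^-1` `]-oo, a[ = [set x | f x < a].
  by apply/seteqP; split=> x /=; rewrite in_itv.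
rewrite setTI; apply: sub_sigma_algebra.
by rewrite openE => x /= fxa; exact: uf _ _ fxa.
Qed.

Lemma Cb_Bb f : Cb f -> Bb f.
Proof. by move=> /Cb_Ub/Ub_Bb. Qed.

Lemma Bb_indic (A : set T) (m : R) :
  measurable (A : set (borel T)) -> Bb (fun x => m * \1_A x).
Proof.
move=> mA; split.
  apply/bounded_existsP; exists `|m| => x; rewrite indicE normrM.
  by case: (x \in A); rewrite ?normr1 ?normr0 ?mulr1 ?mulr0.
apply: measurable_funM; first exact: measurable_cst.
exact: (measurable_indic (T := borel T)).
Qed.

Lemma measurable_closed (A : set T) : closed A -> measurable (A : set (borel T)).
Proof.
move=> cA; rewrite -[A]setCK; apply: measurableC.
by apply: sub_sigma_algebra; exact/closed_openC.
Qed.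

Lemma measurable_open (A : set T) : open A -> measurable (A : set (borel T)).
Proof. by move=> oA; exact: sub_sigma_algebra. Qed.

End bounded_functions.

Lemma subspace_Cb {R : realType} {T : ptopologicalType} :
  @subspace_set R (T -> R^o) (@Cb R T).
Proof.
split; first exact: (@Cb_cst _ _ 0).
by move=> a f g Cf Cg; exact: CbD (CbZ a Cf) Cg.
Qed.

Section pairing.
Context {R : realType} {T : ptopologicalType} (mu : @ca_plus R T).
Implicit Types f g : T -> R.

Lemma Bb_integrable f : Bb f -> mu.-integrable [set: borel T] (EFin \o f).
Proof.
move=> [bf mf]; apply: measurable_bounded_integrable => //.
by rewrite -ge0_fin_numE//; exact: fin_num_measure.
Qed.

Lemma pairingD f g : Bb f -> Bb g ->
  pairing (fun x => f x + g x) mu = pairing f mu + pairing g mu.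
Proof. by move=> Bf Bg; rewrite /pairing RintegralD//; exact: Bb_integrable. Qed.

Lemma pairingZ (a : R) f : Bb f -> pairing (fun x => a * f x) mu = a * pairing f mu.
Proof. by move=> Bf; rewrite /pairing RintegralZl//; exact: Bb_integrable. Qed.

Lemma le_pairing f g : Bb f -> Bb g -> (forall x, f x <= g x) ->
  pairing f mu <= pairing g mu.
Proof.
by move=> Bf Bg fg; apply: le_Rintegral => //; exact: Bb_integrable.
Qed.

Lemma pairing_ge0 f : (forall x, 0 <= f x) -> 0 <= pairing f mu.
Proof. by move=> f0; exact: Rintegral_ge0. Qed.

Lemma pairing_cst (c : R) : pairing (fun=> c) mu = c * fine (mu setT).
Proof. by rewrite /pairing Rintegral_cst. Qed.

Lemma pairing_indic (A : set T) :
  measurable (A : set (borel T)) -> pairing (\1_A : T -> R) mu = fine (mu A).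
Proof.
by move=> mA; rewrite /pairing /Rintegral integral_indic// setIT.
Qed.

Lemma pairing_decr_cvg (f : T -> R) (f_ : nat -> T -> R) : Bb f ->
  (forall j, Bb (f_ j)) -> (forall x, decreases_to (fun j => f_ j x) (f x)) ->
  pairing (f_ j) mu @[j --> \oo] --> pairing f mu.
Proof.
move=> Bf Bf_ ff_.
have /bounded_existsP[M fM] := Bf.1; have /bounded_existsP[N fN] := (Bf_ 0%N).1.
have f_ge j x : f x <= f_ j x by exact: (decreases_to_ge j (ff_ x)).
have bnd j x : `|f_ j x| <= M + N.
  have := f_ge j x; have := (ff_ x).1 _ _ (leq0n j).
  have := fM x; have := fN x; rewrite !ler_norml; lra.
have [| | | | |_ _ h] := @dominated_convergence _ (borel T) R mu setT measurableT
    (fun j x => (f_ j x)%:E) (fun x => (f x)%:E) (fun=> (M + N)%:E).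
- by move=> j; apply/measurable_EFinP; exact: (Bf_ j).2.
- by apply/measurable_EFinP; exact: Bf.2.
- by apply: aeW => x _; apply: cvg_EFin; [exact: nearW |exact: (ff_ x).2 ].
- exact: (Bb_integrable (Cb_Bb (Cb_cst _))).
- by apply: aeW => x j _; rewrite lee_fin.
apply: fine_cvg; rewrite fineK//.
by apply: integrable_fin_num => //; exact: Bb_integrable.
Qed.

End pairing.

(** * Continuous functions on a pseudometric space *)

Section pseudometric.
Context {R : realType} {T : pseudoPMetricType R}.
Implicit Types (x y z : T) (f : T -> R).

(** The distance underlying the balls, truncated at 1 so that it is finite. *)
Definition gap x y : R := inf ([set e | 0 < e /\ ball x e y] `|` [set 1]).

Let gap_lb x y : has_lbound ([set e | 0 < e /\ ball x e y] `|` [set 1]).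
Proof. by exists 0 => _ [[/ltW//]|->]; exact: ler01. Qed.

Lemma gap_ge0 x y : 0 <= gap x y.
Proof.
by apply: lb_le_inf; [exists 1; right|move=> _ [[/ltW//]|->]; exact: ler01].
Qed.

Lemma gap_le x y e : 0 < e -> ball x e y -> gap x y <= e.
Proof. by move=> e0 xy; apply: ge_inf => //; left. Qed.

Lemma gap_le1 x y : gap x y <= 1.
Proof. by apply: ge_inf => //; right. Qed.

Lemma gap_adherent x y e : gap x y < e ->
  exists2 d, d < e & 1 <= d \/ (0 < d /\ ball x d y).
Proof.
rewrite -subr_gt0 => e0.
have [|d Ed] := inf_adherent e0 (conj _ (gap_lb x y)); first by exists 1; right.
by rewrite subrKC => de; exists d => //; case: Ed => [?|->]; [right|left].
Qed.

Lemma gap_lt_ball x y e : gap x y < e -> e <= 1 -> ball x e y.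
Proof.
move=> /gap_adherent[d de [d1 e1|[d0 dxy] _]]; first by lra.
exact: le_ball (ltW de) _ dxy.
Qed.

Lemma gapxx x : gap x x = 0.
Proof.
apply/eqP; rewrite eq_le gap_ge0 andbT; apply/ler_addgt0Pl => e e0.
by rewrite addr0; apply: gap_le => //; exact: ballxx.
Qed.

Lemma gap_sym x y : gap x y = gap y x.
Proof.
suff le x' y' : gap x' y' <= gap y' x' by apply/eqP; rewrite eq_le !le.
apply: lb_le_inf; first by exists 1; right.
by move=> e [[e0 /ball_sym]|->]; [exact: gap_le|rewrite gap_le1].
Qed.

Lemma gap_triangle x y z : gap x z <= gap x y + gap y z.
Proof.
apply/ler_addgt0Pl => e e0; rewrite leNgt; apply/negP => lt.
have [|d dxy hd] := @gap_adherent x y (gap x y + e / 2); first by lra.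
have [|d' dyz hd'] := @gap_adherent y z (gap y z + e / 2); first by lra.
have := gap_ge0 x y; have := gap_ge0 y z; have := gap_le1 x z.
case: hd => [|[d0 bxy]]; first lra; case: hd' => [|[d'0 byz]]; first lra.
by have := gap_le (addr_gt0 d0 d'0) (ball_triangle bxy byz); lra.
Qed.

Lemma lipschitz_continuous (k : R) f :
  (forall x y, f x <= f y + k * gap x y) -> continuous f.
Proof.
move=> fk x; apply/cvgrPdist_le => e e0.
pose d := e / (`|k| + 1).
have k1 : 0 < `|k| + 1 by rewrite ltr_wpDl.
have d0 : 0 < d by rewrite divr_gt0.
have : \forall y \near x, ball x d y by exact: nbhsx_ballx.
apply: filterS => y xy.
have ke : k * gap x y <= e.
  apply: (@le_trans _ _ (`|k| * d)).
    apply: (@le_trans _ _ (`|k| * gap x y)).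
      by rewrite ler_wpM2r ?gap_ge0// ler_norm.
    by rewrite ler_wpM2l// gap_le.
  by rewrite /d mulrCA ger_pMr// ler_pdivrMr// mul1r lerDl.
have := fk x y; have := fk y x; rewrite (gap_sym y x) ler_norml; lra.
Qed.

(** The envelopes [sup_y (f y - j * gap x y)] are [j]-Lipschitz and bounded
    by the bounds of [f]; semicontinuity makes them decrease to [f]. *)
Lemma Ub_approx f : Ub f -> exists f_ : nat -> T -> R,
  (forall j, Cb (f_ j)) /\ (forall x, decreases_to (fun j => f_ j x) (f x)).
Proof.
move=> [/bounded_existsP[M fM] uf].
pose A (j : nat) x := [set f y - j%:R * gap x y | y in [set: T]].
have A0 j x : A j x !=set0 by exists (f x - j%:R * gap x x), x.
have jg (j : nat) x y : 0 <= j%:R * gap x y by rewrite mulr_ge0// gap_ge0.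
have Aub j x r : (forall y, f y - j%:R * gap x y <= r) -> sup (A j x) <= r.
  by move=> h; apply: ge_sup => // _ [y _ <-].
have leA j x y : f y - j%:R * gap x y <= sup (A j x).
  apply: ub_le_sup; last by exists y.
  exists M => _ [z _ <-]; have := fM z; have := jg j x z; rewrite ler_norml; lra.
have fA j x : f x <= sup (A j x).
  by have := leA j x x; rewrite gapxx mulr0 subr0.
exists (fun j x => sup (A j x)); split=> [j|x].
  split.
    apply/bounded_existsP; exists M => x.
    have := fM x; have := fA j x.
    have : sup (A j x) <= M.
      by apply: Aub => y; have := fM y; have := jg j x y; rewrite ler_norml; lra.
    rewrite !ler_norml; lra.
  apply: (@lipschitz_continuous j%:R) => x y; apply: Aub => z.
  have := leA j y z.
  have : j%:R * gap y z <= j%:R * gap x y + j%:R * gap x z.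
    by rewrite -mulrDr ler_wpM2l// (gap_sym x y) gap_triangle.
  lra.
have dec : nonincreasing_seq (fun j => sup (A j x)).
  move=> i j ij; apply: Aub => y; apply: le_trans (leA i x y).
  by rewrite lerB// ler_wpM2r ?gap_ge0// ler_nat.
split=> //; apply/cvgrPdist_le => e e0.
have : \forall y \near x, f y < f x + e by apply: uf; rewrite ltrDl.
move=> /nbhs_ballP[d0 /= d00 xd].
pose d := Num.min d0 1.
have dp : 0 < d by rewrite lt_min d00/=.
have [n nM] : exists n : nat, 2 * M <= n%:R * d.
  by exists (Num.truncn (2 * M / d)).+1; rewrite -ler_pdivrMr// ltW// truncnS_gt.
near=> j.
have nj : (n <= j)%N by near: j; exact: nbhs_infty_ge.
rewrite distrC ger0_norm ?subr_ge0// lerBlDr addrC; apply: Aub => y.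
have [yd|yd] := ltP (gap x y) d.
  have /xd : ball x d0 y.
    by apply: le_ball (gap_lt_ball yd _); rewrite /d ge_min lexx ?orbT.
  by have := jg j x y; lra.
have : n%:R * d <= j%:R * gap x y by rewrite ler_pM ?(ltW dp)// ler_nat.
have := fM x; have := fM y; rewrite !ler_norml; lra.
Unshelve. all: by end_near. Qed.

Lemma Ub_indic (A : set T) : closed A -> Ub (\1_A : T -> R).
Proof.
move=> cA; split.
  apply/bounded_existsP; exists 1 => x; rewrite indicE.
  by case: (x \in A); rewrite ?normr1 ?normr0.
move=> x a; rewrite indicE; have [xA|xA] := boolP (x \in A) => /= xa.
  by apply: nearW => y; rewrite indicE (le_lt_trans _ xa)// ler_nat leq_b1.
have : \forall y \near x, (~` A) y.
  by have := closed_openC cA; rewrite openE; apply; move/negP: xA; rewrite inE.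
by apply: filterS => y yA; rewrite indicE memNset.
Qed.

Lemma open_approx (U : set T) : open U -> exists psi : nat -> T -> R,
  [/\ forall k, Cb (psi k), forall k x, 0 <= psi k x <= 1,
      forall k x, ~ U x -> psi k x = 0,
      forall x, nondecreasing_seq (psi^~ x) &
      forall x c, U x -> c < 1 -> exists k, c <= psi k x].
Proof.
move=> oU; have [f [Cf dec]] := Ub_approx (Ub_indic (open_closedC oU)).
have f_ge j x : (\1_(~` U) x : R) <= f j x by exact: (decreases_to_ge j (dec x)).
exists (fun k x => 1 - Num.min 1 (f k x)); split.
- by move=> k; apply: CbB; [exact: Cb_cst|apply: Cb_min => //; exact: Cb_cst].
- move=> k x; rewrite subr_ge0 ge_min lexx/= lerBlDr lerDl le_min ler01/=.
  by apply: le_trans (f_ge k x); rewrite indicE ler0n.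
- move=> k x nUx; have := f_ge k x; rewrite indicE mem_set// => f1.
  by rewrite (min_idPl f1) subrr.
- by move=> x i j ij; rewrite lerB// le_min2 ?(dec x).1.
- move=> x c Ux c1; have := (dec x).2; rewrite indicE memNset; last by move=> /(_ Ux).
  move=> /cvgrPdist_le/(_ (1 - c)); rewrite subr_gt0 => /(_ c1)[k _ /(_ k)/=].
  rewrite sub0r normrN leqnn => /(_ isT); rewrite ler_norml => fk; exists k.
  by rewrite lerBrDr -lerBrDl ge_min; apply/orP; right; lra.
Qed.

(** Equal to 1 at distance at most [1/(q+1)] from [z], and to 0 beyond twice that. *)
Definition plateau z (q : nat) y : R :=
  Num.min 1 (Num.max 0 (2 - q.+1%:R * gap z y)).

Lemma Cb_plateau z q : Cb (plateau z q).
Proof.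
apply: Cb_min; first exact: Cb_cst.
apply: Cb_max; first exact: Cb_cst.
apply: CbB; first exact: Cb_cst.
apply: CbZ; split.
  by apply/bounded_existsP; exists 1 => y; rewrite ger0_norm ?gap_ge0// gap_le1.
apply: (@lipschitz_continuous 1) => x y.
by rewrite mul1r (gap_sym x y) gap_triangle.
Qed.

Lemma compact_net (K : set T) (q : nat) : compact K ->
  exists s : seq T, forall x, K x -> exists2 z, z \in s & gap x z < q.+1%:R^-1.
Proof.
rewrite compact_cover => /(_ T setT (fun z => [set x | gap x z < q.+1%:R^-1])).
case=> [z _|x Kx|F _ KF].
- apply: (@open_comp _ _ (fun x => gap x z) [set r | r < q.+1%:R^-1]).
    move=> x _; apply: (@lipschitz_continuous 1) => {}x y.
    by rewrite mul1r addrC gap_triangle.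
  exact: open_lt.
- by exists x => //=; rewrite gapxx invr_gt0.
- by exists (finmap.enum_fset F) => x /KF[z zF]; exists z.
Qed.

(** Finite maxima of plateaus with rational heights, centred at finite nets of the
    given compact sets. Every plateau that fits below [f + e] may be used, and near
    each point of [K m] one of them exceeds [f - e]; by compactness finitely many
    suffice. *)
Lemma countable_dense_Cb (K : nat -> set T) : (forall m, compact (K m)) ->
  exists G : nat -> T -> R, [/\ forall k, Cb (G k), forall k x, 0 <= G k x &
    forall f m e, Cb f -> (forall x, 0 <= f x) -> 0 < e ->
      exists k, (forall x, G k x <= f x + e) /\
                (forall x, K m x -> f x <= G k x + e)].
Proof.
move=> cK; have [net netP] := choice (fun mq => compact_net mq.2 (cK mq.1)).
pose J := (nat * nat * nat * nat)%type.
pose b (j : J) y : R := let: (m, q, i, c) := j in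
  c%:R / q.+1%:R * plateau (nth point (net (m, q)) i) q y.
have Cbj j : Cb (b j).
  by case: j => [[[m q] i] c]; apply: CbZ; exact: Cb_plateau.
pose G k y : R := if @unpickle (seq J) k is Some s
  then \big[Num.max/0]_(j <- s) b j y else 0.
exists G; split=> [k|k x|f m e Cf f0 e0].
- rewrite /G; case: unpickle => [s|]; last exact: Cb_cst.
  exact: Cb_bigmax.
- by rewrite /G; case: unpickle => // s; exact: bigmax_ge_id.
have := cK m; rewrite compact_cover.
move=> /(_ _ [set j : J | forall y, b j y <= f y + e]
  (fun j => [set y | f y - e < b j y])).
case=> [j _|x Kx|F FD KF].
- rewrite (_ : [set y | _] = (fun y => b j y - f y + e) @^-1` [set r | 0 < r]).
    apply: open_comp; last exact: open_gt.
    move=> y _; have [_] := CbD (CbB (Cbj j) Cf) (Cb_cst e).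
    exact.
  by apply/funext => y /=; apply/propext; split; lra.
- have e2 : 0 < e / 2 by rewrite divr_gt0.
  have /cvgrPdist_lt/(_ _ e2)/nbhs_ballP[d0 /= d00 xd] := Cf.2 x.
  pose d := Num.min d0 1.
  have dp : 0 < d by rewrite lt_min d00/=.
  have [q [qd qe]] : exists q : nat, 3 < q.+1%:R * d /\ 1 < q.+1%:R * (e / 2).
    exists (Num.truncn (3 / d) + Num.truncn (1 / (e / 2)))%N.
    rewrite -(ltr_pdivrMr _ _ dp) -(ltr_pdivrMr _ _ e2).
    split; apply: lt_le_trans (truncnS_gt _) _; rewrite ler_nat ltnS.
      exact: leq_addr.
    exact: leq_addl.
  have q0 : 0 < q.+1%:R :> R by [].
  have [z zs xz] := netP (m, q) x Kx.
  have {}xz : q.+1%:R * gap x z < 1 by rewrite mulrC -ltr_pdivlMr// mul1r.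
  have fq : 0 <= f x * q.+1%:R by rewrite mulr_ge0.
  have /andP[c1 c2] := truncn_itv fq.
  set c := Num.truncn (f x * q.+1%:R) in c1 c2.
  have cf : c%:R / q.+1%:R <= f x by rewrite ler_pdivrMr.
  have fc : f x - e / 2 < c%:R / q.+1%:R.
    rewrite ltr_pdivlMr//; rewrite -natr1 in c2; lra.
  have cq : 0 <= c%:R / q.+1%:R :> R by rewrite divr_ge0.
  exists (m, q, index z (net (m, q)), c) => /=; last first.
    rewrite nth_index//.
    have -> : plateau z q x = 1.
      have q1 : 1 <= 2 - q.+1%:R * gap x z by lra.
      by rewrite /plateau gap_sym; apply/min_idPl; rewrite le_max q1 orbT.
    by rewrite mulr1; apply: lt_trans fc; lra.
  move=> y; rewrite nth_index//.
  have b01 : 0 <= plateau z q y <= 1.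
    by rewrite /plateau le_min ler01 le_max lexx ge_min lexx.
  have [yz|yz] := ltP (q.+1%:R * gap z y) 2; last first.
    have -> : plateau z q y = 0.
      rewrite /plateau (max_idPl _); last lra.
      by apply/min_idPr; exact: ler01.
    by rewrite mulr0 addr_ge0// ltW.
  have : `|f x - f y| < e / 2.
    apply: xd; apply: (@le_ball _ _ _ d); first by rewrite ge_min lexx.
    apply: gap_lt_ball; last by rewrite ge_min lexx orbT.
    rewrite -(ltr_pM2l q0); apply: le_lt_trans _ qd.
    have : q.+1%:R * gap x y <= q.+1%:R * gap x z + q.+1%:R * gap z y.
      by rewrite -mulrDr ler_pM2l// gap_triangle.
    lra.
  have : c%:R / q.+1%:R * plateau z q y <= c%:R / q.+1%:R.
    by case/andP: b01 => _ b1; rewrite -[leRHS]mulr1 ler_wpM2l.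
  move=> /le_trans hb; rewrite ltr_norml => fxy; apply/hb/(le_trans cf); lra.
exists (pickle (finmap.enum_fset F)); rewrite /G pickleK; split=> x => [|Kx].
  rewrite big_seq; apply: bigmax_le => [|j jF]; first by rewrite addr_ge0// ltW.
  by have /FD := jF; rewrite inE; apply.
have [j /= jF] := KF _ Kx; rewrite ltrBlDr => /ltW/le_trans; apply.
by rewrite lerD2r; exact: (Order.TotalTheory.le_bigmax_seq 0 j xpredT (b^~ x) jF isT).
Qed.

End pseudometric.

(** * Tight positive functionals are finite measures *)

Record tight_functional (R : realType) (T : pseudoPMetricType R) := TightFunctional {
  tight_fun :> (T -> R) -> R ;
  tight_linear : @linear_on R (T -> R^o) Cb tight_fun ;
  tight_ge0 : forall f, Cb f -> (forall x, 0 <= f x) -> 0 <= tight_fun f ;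
  tight_tight : forall d : R, 0 < d -> exists2 K : set T, compact K &
    forall h, Cb h -> (forall x, 0 <= h x <= 1) -> (forall x, K x -> h x = 0) ->
      tight_fun h <= d }.

Section linear_on_Cb.
Context {R : realType} {T : ptopologicalType} (L : (T -> R) -> R).
Hypothesis linL : @linear_on R (T -> R^o) Cb L.
Hypothesis posL : forall f, Cb f -> (forall x, 0 <= f x) -> 0 <= L f.
Implicit Types f g : T -> R.

Lemma linear_CbD f g : Cb f -> Cb g -> L (fun x => f x + g x) = L f + L g.
Proof.
move=> Cf Cg; rewrite -[L f]mul1r -(linL 1 Cf Cg); congr L.
by apply/funext => x; rewrite /= scale1r.
Qed.

Lemma linear_CbZ (a : R) f : Cb f -> L (fun x => a * f x) = a * L f.
Proof.
have L0 : L (fun=> 0) = 0.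
  have := linear_CbD (Cb_cst 0) (Cb_cst 0).
  by under eq_fun do rewrite addr0; lra.
move=> Cf; have := linL a Cf (Cb_cst 0); rewrite L0 => La; rewrite -[RHS]addr0 -La.
by congr L; apply/funext => x; rewrite /= addr0.
Qed.

Lemma linear_CbB f g : Cb f -> Cb g -> L (fun x => f x - g x) = L f - L g.
Proof.
move=> Cf Cg; rewrite linear_CbD//; last exact: CbN.
under [X in _ + L X]eq_fun do rewrite -mulN1r.
by rewrite linear_CbZ// mulN1r.
Qed.

Lemma linear_Cb_sum n (F : nat -> T -> R) : (forall i, Cb (F i)) ->
  L (fun x => \sum_(i < n) F i x) = \sum_(i < n) L (F i).
Proof.
move=> CF; elim: n => [|n ih].
  rewrite big_ord0; under eq_fun do rewrite big_ord0 -(mul0r 0).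
  by rewrite (linear_CbZ 0 (Cb_cst 0)) mul0r.
under eq_fun do rewrite big_ord_recr.
rewrite linear_CbD ?ih ?big_ord_recr//; exact: Cb_sum.
Qed.

Lemma positive_Cb_le f g : Cb f -> Cb g -> (forall x, f x <= g x) -> L f <= L g.
Proof.
move=> Cf Cg fg; rewrite -subr_ge0 -linear_CbB//.
by apply: posL => [|x]; [exact: CbB|rewrite subr_ge0].
Qed.

End linear_on_Cb.

Section riesz.
Context {R : realType} {T : pseudoPMetricType R} (L : tight_functional T).
Implicit Types (f g : T -> R) (A U X : set T) (h : nat -> T -> R).

Let LD := linear_CbD (tight_linear L).
Let LZ := linear_CbZ (tight_linear L).
Let LB := linear_CbB (tight_linear L).
Let Lsum := linear_Cb_sum (tight_linear L).
Let L_le := positive_Cb_le (tight_linear L) (@tight_ge0 _ _ L).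

(** Increasing sequences rather than series of continuous functions: covers of
    countably many sets are then merged diagonally. *)
Definition covers A h :=
  [/\ forall n, Cb (h n), forall n x, 0 <= h n x,
      forall x, nondecreasing_seq (h^~ x) &
      forall x c, A x -> c < 1 -> exists n, c <= h n x].

Definition outer_content A : R :=
  inf [set s | exists2 h, covers A h & forall n, L (h n) <= s].

Let content_lb A : lbound [set s | exists2 h, covers A h & forall n, L (h n) <= s] 0.
Proof. by move=> s [h [Ch h0 _ _] /(_ 0%N)]; apply: le_trans; exact: tight_ge0. Qed.

Lemma covers_cst A f : Cb f -> (forall x, 0 <= f x) ->
  (forall x, A x -> 1 <= f x) -> covers A (fun=> f).
Proof.
move=> Cf f0 f1; split=> // [x m n _|x c Ax c1]; first exact: lexx.
by exists 0%N; rewrite (le_trans (ltW c1))// f1.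
Qed.

Let content_has_inf A :
  has_inf [set s | exists2 h, covers A h & forall n, L (h n) <= s].
Proof.
split; last by exists 0; exact: content_lb.
exists (L (fun=> 1)), (fun=> fun=> 1) => //.
by apply: covers_cst => //; exact: Cb_cst.
Qed.

Lemma outer_content_le A h s :
  covers A h -> (forall n, L (h n) <= s) -> outer_content A <= s.
Proof. by move=> Ah hs; apply: ge_inf; [exact: (content_has_inf A).2|exists h]. Qed.

Lemma outer_content_ge A s :
  (forall h r, covers A h -> (forall n, L (h n) <= r) -> s <= r) ->
  s <= outer_content A.
Proof.
move=> hs; apply: lb_le_inf; first exact: (content_has_inf A).1.
by move=> r [h Ah hr]; exact: hs Ah hr.
Qed.

Lemma outer_content_adherent A e : 0 < e ->
  exists2 h, covers A h & forall n, L (h n) <= outer_content A + e.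
Proof.
move=> e0; have [s [h Ah hs] se] := inf_adherent e0 (content_has_inf A).
by exists h => // n; rewrite (le_trans (hs n))// ltW.
Qed.

Definition riesz_outer A : \bar R := (outer_content A)%:E.

Let riesz_outer0 : riesz_outer set0 = 0%E.
Proof.
congr EFin; apply/eqP; rewrite eq_le outer_content_ge ?andbT//; last first.
  by move=> h r [Ch h0 _ _] /(_ 0%N); apply: le_trans; exact: tight_ge0.
apply: (@outer_content_le _ (fun=> fun=> 0)).
  by apply: covers_cst => //; exact: Cb_cst.
by move=> _; under eq_fun do rewrite -(mul0r 0); rewrite (LZ 0 (Cb_cst 0)) mul0r.
Qed.

Let riesz_outer_ge0 A : (0 <= riesz_outer A)%E.
Proof.
rewrite lee_fin; apply: outer_content_ge.
by move=> h r [Ch h0 _ _] /(_ 0%N); apply: le_trans; exact: tight_ge0.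
Qed.

Let le_riesz_outer : {homo riesz_outer : A B / A `<=` B >-> (A <= B)%E}.
Proof.
move=> A B AB; rewrite lee_fin; apply: outer_content_ge => h r [? ? ? hB].
by apply: outer_content_le; split=> // x c /AB; exact: hB.
Qed.

Let riesz_outer_subadditive : sigma_subadditive riesz_outer.
Proof.
move=> A; apply/lee_addgt0Pr => e e0.
have e2 n : 0 < e / 2 ^+ n.+1 by rewrite divr_gt0// exprn_gt0.
have [h hP] := choice (fun n =>
  let: ex_intro2 h a b := outer_content_adherent (A n) (e2 n) in
  ex_intro (fun h => covers (A n) h /\ _) h (conj a b)).
pose H N x := \sum_(n < N) h n N x.
have h0 n k x : 0 <= h n k x by have [[_ + _ _] _] := hP n; exact.
have Ch n k : Cb (h n k) by have [[+ _ _ _] _] := hP n; exact.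
have hnd n x : nondecreasing_seq ((h n)^~ x) by have [[_ _ + _] _] := hP n; exact.
have HA : covers (\bigcup_n A n) H.
  split=> [N|N x|x|x c [n _ Anx] c1].
  - exact: Cb_sum.
  - by apply: sumr_ge0.
  - apply/nondecreasing_seqP => N; rewrite /H big_ord_recr/= -[leLHS]addr0 lerD//.
    by apply: ler_sum => i _; apply: hnd.
  - have [[_ _ _ hc] _] := hP n; have [k ck] := hc _ _ Anx c1.
    exists (maxn k n.+1); rewrite /H (bigD1 (Ordinal (leq_maxr k n.+1)))//=.
    rewrite -[c]addr0 lerD ?sumr_ge0// (le_trans ck)//.
    by apply: hnd; exact: leq_maxl.
have sumN N : \sum_(n < N) (e / 2 ^+ n.+1) = e - e / 2 ^+ N.
  elim: N => [|N ih]; first by rewrite big_ord0 expr0 divr1 subrr.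
  by rewrite big_ord_recr/= ih exprS; field; rewrite expf_neq0.
have LHN N : ((L (H N))%:E <= \sum_(0 <= i <oo) riesz_outer (A i) + e%:E)%E.
  apply: (@le_trans _ _ (\sum_(0 <= i < N) riesz_outer (A i) + e%:E)%E); last first.
    by rewrite leeD2r// nneseries_lim_ge.
  rewrite big_mkord sumEFin -EFinD lee_fin (Lsum N (F := fun n => h n N))//.
  apply: (@le_trans _ _ (\sum_(n < N) (outer_content (A n) + e / 2 ^+ n.+1))).
    by apply: ler_sum => n _; exact: (hP n).2.
  by rewrite big_split/= lerD2l sumN gerBl ltW// divr_gt0// exprn_gt0.
move: LHN; case: (\sum_(0 <= i <oo) _)%E => [s| |] LHN; last 2 first.
- by rewrite addye// leey.
- by have := LHN 0%N; rewrite addNye.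
by rewrite -EFinD lee_fin; apply: (outer_content_le HA) => N; have := LHN N.
Qed.

HB.instance Definition _ := isOuterMeasure.Build R T riesz_outer
  riesz_outer0 riesz_outer_ge0 le_riesz_outer riesz_outer_subadditive.

(** An open set splits every cover [h] of [X]: with [psi] increasing to its
    indicator, [min h psi] covers the part inside, and [h - min h (psi k)], for
    a fixed large [k], covers the part outside at almost the remaining cost. *)
Lemma open_caratheodory U : open U -> riesz_outer.-caratheodory U.
Proof.
move=> /open_approx[psi [Cpsi psi01 psi0 psind psi1]].
apply: le_caratheodory_measurable => X.
apply/lee_addgt0Pr => e e0; rewrite -!EFinD lee_fin.
have [|h [Ch h0 hnd hX] hL] := @outer_content_adherent X (e / 2).
  by rewrite divr_gt0.
pose m n x := Num.min (h n x) (psi n x).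
have Cm n : Cb (m n) by exact: Cb_min.
have mL n : L (m n) <= outer_content X + e / 2.
  apply: le_trans (hL n); apply: L_le => // x.
  by rewrite ge_min lexx.
pose s := sup (range (L \o m)).
have hs : has_sup (range (L \o m)).
  split; first by exists (L (m 0%N)), 0%N.
  by exists (outer_content X + e / 2) => _ [n _ <-]; exact: mL.
have ms : outer_content (X `&` U) <= s.
  apply: (@outer_content_le _ m); last first.
    by move=> n; apply: ub_le_sup; [exact: hs.2|exists n].
  split=> [//|n x|x i j ij|x c [Xx Ux] c1].
  - by rewrite le_min h0; have /andP[] := psi01 n x.
  - by rewrite /m le_min2 ?hnd ?psind.
  - have [i ci] := hX _ _ Xx c1; have [j cj] := psi1 _ _ Ux c1.
    exists (maxn i j); rewrite /m le_min (le_trans ci) ?hnd ?leq_maxl//=.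
    by rewrite (le_trans cj)// psind// leq_maxr.
have e2 : 0 < e / 2 by rewrite divr_gt0.
have [_ [k _ <-] /= sk] := sup_adherent e2 hs.
pose r n x := h (n + k)%N x - Num.min (h (n + k)%N x) (psi k x).
suff : outer_content (X `&` ~` U) <= outer_content X + e - s by rewrite -/s; lra.
apply: (@outer_content_le _ r).
  split=> [n|n x|x i j ij|x c [Xx nUx] c1].
  - by apply: CbB => //; exact: Cb_min.
  - by rewrite subr_ge0 ge_min lexx.
  - have := hnd x _ _ (leq_add ij (leqnn k)).
    by rewrite /r/=; case: (leP _ (psi k x)); case: (leP (h (j + k)%N x) (psi k x)); lra.
  - have [i ci] := hX _ _ Xx c1; exists i; rewrite /r psi0//.
    by rewrite (min_idPr (h0 _ _)) subr0 (le_trans ci)// hnd// leq_addr.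
move=> n; rewrite /r LB//; last exact: Cb_min.
have : L (m k) <= L (fun x => Num.min (h (n + k)%N x) (psi k x)).
  apply: L_le => //; first exact: Cb_min.
  by move=> x; rewrite /m le_min2// hnd// leq_addl.
have := hL (n + k)%N.
by rewrite -/s in sk; lra.
Qed.

Lemma borel_caratheodory A :
  measurable (A : set (borel T)) -> riesz_outer.-caratheodory A.
Proof.
move: A; apply: smallest_sub => [|U]; last exact: open_caratheodory.
exact: (@sigma_algebra_measurable _ (caratheodory_type riesz_outer)).
Qed.

Definition riesz_measure : set (borel T) -> \bar R := riesz_outer.

Let riesz_measure_sigma_additive : semi_sigma_additive riesz_measure.
Proof.
move=> F mF tF mUF.
by apply: (@caratheodory_measure_sigma_additive _ _ riesz_outer) => // [i|];
  exact: borel_caratheodory.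
Qed.

HB.instance Definition _ := isMeasure.Build _ (borel T) R riesz_measure
  riesz_outer0 riesz_outer_ge0 riesz_measure_sigma_additive.

Let riesz_measure_fin_num : fin_num_fun riesz_measure.
Proof. by []. Qed.

HB.instance Definition _ := Measure_isFinite.Build _ (borel T) R riesz_measure
  riesz_measure_fin_num.

(** The only place where tightness enters: if [h] increases to at least 1, then
    by Dini's argument [h N > 1 - eta] on a compact set outside of which [L] is
    negligible, so that [L (h N)] almost reaches [L 1]. *)
Lemma outer_content_setT : outer_content setT = L (fun=> 1).
Proof.
have C1 : Cb (fun _ : T => 1 : R) by exact: Cb_cst.
apply/eqP; rewrite eq_le; apply/andP; split.
  by apply: (@outer_content_le _ (fun=> fun=> 1)) => //; exact: covers_cst.
apply: outer_content_ge => h s [Ch h0 hnd hT] hs.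
apply/ler_addgt0Pr => e e0.
have L1 : 0 <= L (fun=> 1) by exact: tight_ge0.
pose eta := (e / 2) / (L (fun=> 1) + 1).
have L1p : 0 < L (fun=> 1) + 1 by lra.
have eta0 : 0 < eta by rewrite !divr_gt0.
have etaL : eta * L (fun=> 1) <= e / 2.
  by rewrite /eta mulrAC ler_pdivrMr// ler_pM2l ?divr_gt0//; lra.
have [|K cK KL] := @tight_tight _ _ L (e / 2); first by rewrite divr_gt0.
have [N hN] : exists N, forall x, K x -> 1 - eta <= h N x.
  move: cK; rewrite compact_cover.
  move=> /(_ _ setT (fun n => [set x | 1 - eta < h n x])).
  case=> [n _|x Kx|F _ KF].
  - apply: (@open_comp _ _ (h n) [set r | 1 - eta < r]); last exact: open_gt.
    by move=> x _; exact: (Ch n).2.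
  - have [|n hn] := @hT x (1 - eta / 2) I; first by rewrite ltrBlDr ltrDl divr_gt0.
    by exists n => //=; apply: lt_le_trans hn; lra.
  exists (\max_(n <- finmap.enum_fset F) n)%N => x /KF[n nF /= /ltW hn].
  by apply: (le_trans hn); apply: hnd; exact: leq_bigmax_seq.
pose g x := Num.max 0 (1 - eta - h N x).
have Cg : Cb g.
  apply: Cb_max; first exact: Cb_cst.
  by apply: CbB => //; exact: Cb_cst.
have Lg : L g <= e / 2.
  apply: KL => // [x|x Kx].
    rewrite le_max lexx ge_max ler01/=; have := h0 N x; lra.
  by apply/max_idPl; have := hN _ Kx; lra.
have Ce : Cb (fun _ : T => eta * 1) by exact: Cb_cst.
have -> : s + e = s + (e / 2 + e / 2) by lra.
apply: (@le_trans _ _ (L (fun x => h N x + (eta * 1 + g x)))).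
  apply: L_le => //; first by do 2 apply: CbD => //.
  by move=> x; have := le_max (1 - eta - h N x) 0 (1 - eta - h N x);
    rewrite lexx orbT -/(g x) => /idP; lra.
rewrite LD//; last exact: CbD.
by rewrite LD// (LZ eta C1) lerD// lerD.
Qed.

(** Layer-cake: [f] is the sum of the slices of height [1/N]; a slice is at most
    [1/N] times the indicator of the level set it starts from, and is at least
    [1/N] on the next level set, so [N] times it covers that set. *)
Lemma riesz_pairing_le f : Cb f -> (forall x, 0 <= f x <= 1) ->
  pairing f riesz_measure <= L f.
Proof.
move=> Cf f01; have L1 : 0 <= L (fun=> 1) by apply: tight_ge0 => //; exact: Cb_cst.
suff bound n : pairing f riesz_measure <= L (fun=> 1) / n.+1%:R + L f.
  apply/ler_addgt0Pl => e e0.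
  apply: (le_trans (bound (Num.truncn (L (fun=> 1) / e)))).
  rewrite lerD2r ler_pdivrMr// mulrC -ler_pdivrMr//.
  by rewrite ltW// truncnS_gt.
pose N : R := n.+1%:R.
have N0 : 0 < N by [].
pose t (k : nat) x := Num.min (f x) (k%:R / N).
pose s k x := t k.+1 x - t k x.
have Ct k : Cb (t k) by apply: Cb_min => //; exact: Cb_cst.
have Cs k : Cb (s k) by exact: CbB.
have kN k : k.+1%:R / N = k%:R / N + N^-1 :> R by rewrite -natr1 mulrDl mul1r.
have iN0 : 0 < N^-1 by rewrite invr_gt0.
have fE : f = fun x => \sum_(k < n.+1) s k x.
  apply/funext => x; rewrite -(big_mkord xpredT (s^~ x)).
  rewrite (telescope_sumr (t^~ x))// /t mul0r divff ?gt_eqF//.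
  by have /andP[f0 f1] := f01 x; rewrite (min_idPl f1) (min_idPr f0) subr0.
pose A k := [set x | k%:R / N <= f x].
have mA k : measurable (A k : set (borel T)).
  apply: measurable_closed.
  apply: (@closed_comp _ _ f [set r | k%:R / N <= r]); last exact: closed_ge.
  by move=> x _; exact: Cf.2.
have slice (y a b : R) : 0 < b -> let d := Num.min y (a + b) - Num.min y a in
    [/\ 0 <= d <= b, a + b <= y -> d = b & y < a -> d = 0].
  by move=> b0 /=; case: (leP y a); case: (leP y (a + b)); split; lra.
have sP k x : [/\ 0 <= s k x <= N^-1, A k.+1 x -> s k x = N^-1 &
    ~ A k x -> s k x = 0].
  rewrite /s /t /A/= !kN; have [? ? h] := slice (f x) (k%:R / N) _ iN0.
  by split=> // /negP; rewrite -ltNge.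
have s0 k x : 0 <= s k x by have [/andP[]] := sP k x.
have sA k : pairing (s k) riesz_measure <= N^-1 * outer_content (A k).
  have -> : outer_content (A k) = pairing (\1_(A k)) riesz_measure.
    by rewrite pairing_indic.
  have B1 : Bb (\1_(A k) : T -> R).
    rewrite (_ : \1_(A k) = (fun x => 1 * \1_(A k) x)); first exact: Bb_indic.
    by apply/funext => x; rewrite mul1r.
  rewrite -pairingZ//; apply: le_pairing; first exact: Cb_Bb.
    exact: Bb_indic.
  move=> x; rewrite indicE; have [|] := boolP (x \in A k).
    by rewrite mulr1; have [/andP[]] := sP k x.
  by move=> /negP; rewrite inE; have [_ _ h] := sP k x => /h ->; rewrite mulr0.
have As k : outer_content (A k.+1) <= N * L (s k).
  rewrite -(LZ N (Cs k)); apply: (@outer_content_le _ (fun=> fun x => N * s k x)) => //.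
  apply: covers_cst; first exact: CbZ.
    by move=> x; rewrite mulr_ge0// ltW.
  by move=> x Ax; have [_ /(_ Ax) ->] := sP k x; rewrite divff ?gt_eqF.
have pE : pairing f riesz_measure = \sum_(k < n.+1) pairing (s k) riesz_measure.
  rewrite {1}fE; elim: n.+1 => [|m ih].
    rewrite big_ord0; under eq_fun do rewrite big_ord0.
    by rewrite pairing_cst mul0r.
  rewrite big_ord_recr/= -ih -pairingD; last 2 first.
  - by apply/Cb_Bb/Cb_sum.
  - exact: Cb_Bb.
  by congr pairing; apply/funext => x; rewrite big_ord_recr.
rewrite pE [in leRHS]fE Lsum// big_ord_recl big_ord_recr/=.
apply: lerD.
  rewrite mulrC (le_trans (sA 0%N))// ler_pM2l//.
  rewrite -outer_content_setT -lee_fin; exact: le_riesz_outer.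
rewrite -[leLHS]addr0 lerD//; last by apply: tight_ge0.
apply: ler_sum => k _; rewrite /bump/= add1n (le_trans (sA _))//.
by rewrite mulrC ler_pdivrMr// mulrC.
Qed.

(** The upper bound applied to both [g] and [1 - g] leaves no room, since the
    total mass is [L 1]; affine rescaling reaches every bounded function. *)
Lemma riesz_pairing f : Cb f -> L f = pairing f riesz_measure.
Proof.
have C1 : Cb (fun _ : T => 1 : R) by exact: Cb_cst.
have p1 : pairing (fun=> 1) riesz_measure = L (fun=> 1).
  by rewrite pairing_cst mul1r -outer_content_setT.
have eq01 g : Cb g -> (forall x, 0 <= g x <= 1) -> L g = pairing g riesz_measure.
  move=> Cg g01; apply/eqP; rewrite eq_le riesz_pairing_le// andbT.
  have Cg' : Cb (fun x => -1 * g x) by exact: CbZ.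
  have := @riesz_pairing_le (fun x => 1 + -1 * g x) (CbD C1 Cg').
  rewrite pairingD; [|exact: Cb_Bb|exact: Cb_Bb].
  rewrite pairingZ ?p1; last exact: Cb_Bb.
  rewrite LD// LZ// lerD2l !mulN1r lerN2; apply.
  by move=> x; have := g01 x; lra.
move=> Cf; have /bounded_existsP[M fM] := Cf.1.
pose M' := `|M| + 1.
have M0 : 0 < M' by rewrite ltr_wpDl.
pose g x := (2 * M')^-1 * (f x + M' * 1).
have Cg : Cb g by apply/CbZ/CbD => //; exact: Cb_cst.
have fE : f = fun x => 2 * M' * g x + - M' * 1.
  by apply/funext => x; rewrite /g; field; rewrite gt_eqF.
have Bg := Cb_Bb Cg; have B1 := Cb_Bb C1.
have C2 := CbZ (2 * M') Cg; have C3 := CbZ (- M') C1.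
have -> : L f = 2 * M' * L g + - M' * L (fun=> 1).
  by rewrite [in LHS]fE (LD C2 C3) (LZ _ Cg) (LZ _ C1).
have -> : pairing f riesz_measure = 2 * M' * pairing g riesz_measure +
    - M' * pairing (fun=> 1) riesz_measure.
  rewrite [in LHS]fE (pairingD _ (Cb_Bb C2) (Cb_Bb C3)).
  by rewrite (pairingZ _ _ Bg) (pairingZ _ _ B1).
rewrite p1 eq01// => x.
have := fM x; rewrite /g ler_norml => /andP[f1 f2].
have := ler_norm M. rewrite mulr1 => MM.
rewrite mulr_ge0 ?invr_ge0 ?mulr_ge0 ?(ltW M0)//=; last by rewrite /M'; lra.
by rewrite mulrC ler_pdivrMr ?mulr_gt0// mul1r /M'; lra.
Qed.

End riesz.

(** * Level sets of the conjugate *)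

Lemma ultra_bounded_cvg {R : realType} {S : Type} (F : set_system S)
    (v : S -> R) (c : R) : UltraFilter F -> (forall n, `|v n| <= c) ->
  exists l : R, v @ F --> l.
Proof.
move=> FU vc.
have [|l [_ lcl]] := @segment_compact R (- c) c (v @ F) _.
  by apply: nearW => n; rewrite /= in_itv/= -ler_norml.
exists l => V lV; have [//|FnV] := in_ultra_setVsetC (v @^-1` V) FU.
have [y [nVy Vy]] := lcl (~` V) V FnV lV.
by case: nVy.
Qed.

Section levels.
Context {R : realType} {T : pseudoPMetricType R}.
Variable phi : (T -> R) -> R.
Hypothesis phi_increasing : forall f g, Bb f -> Bb g ->
  (forall x, g x <= f x) -> phi g <= phi f.
Hypothesis phi_tight : forall m e : R, 0 < m -> 0 < e ->
  exists K : set T, [/\ compact K, closed K &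
    phi (fun x => m * \1_(~` K) x) <= e].
Implicit Types (f g h : T -> R) (L : (T -> R) -> R) (mu : @ca_plus R T) (a : R).

(** The finitely additive counterpart of the level set [conjugate <= a]: limits
    along ultrafilters and subgradients of [phi] land here. *)
Record level a L : Prop := Level {
  level_linear : @linear_on R (T -> R^o) Cb L ;
  level_ge0 : forall f, Cb f -> (forall x, 0 <= f x) -> 0 <= L f ;
  level_le : forall f, Cb f -> L f <= a + phi f }.

(** For [h] vanishing on [K], [m L(h) <= a + phi (m 1_(~K))], and the right-hand
    side stays bounded when [m] is large and [K] is adapted to [m]. *)
Lemma level_tight a (d : R) : 0 < d -> exists2 K : set T, compact K &
  forall L h, level a L -> Cb h -> (forall x, 0 <= h x <= 1) ->
    (forall x, K x -> h x = 0) -> L h <= d.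
Proof.
move=> d0; pose m := (`|a| + 1) / d.
have m0 : 0 < m by rewrite divr_gt0// ltr_wpDl.
have [K [cK clK phiK]] := phi_tight m0 ltr01.
exists K => // L h [linL posL leL] Ch h01 hK.
have mK : measurable (~` K : set (borel T))
    by exact: (@measurable_open T _ (closed_openC clK)).
rewrite -(ler_pM2l m0) -(linear_CbZ linL m Ch).
apply: (le_trans (leL _ (CbZ m Ch))).
have -> : m * d = `|a| + 1 by rewrite /m divfK// gt_eqF.
apply: lerD; first exact: ler_norm.
apply: le_trans phiK; apply: phi_increasing; [exact: Bb_indic|exact/Cb_Bb/CbZ|].
move=> x; rewrite ler_pM2l// indicE; have [|/negP] := boolP (x \in ~` K).
  by have /andP[] := h01 x.
by rewrite inE => /contrapT/hK ->.
Qed.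

Lemma level_measure a L : level a L ->
  exists mu, forall f, Cb f -> L f = pairing f mu.
Proof.
move=> La; have [linL posL _] := La.
have tL (d : R) : 0 < d -> exists2 K : set T, compact K &
    forall h, Cb h -> (forall x, 0 <= h x <= 1) -> (forall x, K x -> h x = 0) ->
    L h <= d.
  by move=> /(level_tight a)[K cK KL]; exists K => // h; exact: KL.
pose tf := TightFunctional linL posL tL.
by exists (riesz_measure tf) => f Cf; exact: (@riesz_pairing _ _ tf).
Qed.

Lemma conjugate_leP (D : set (T -> R)) mu a :
  (conjugate D phi mu <= a%:E)%E <-> forall f, D f -> pairing f mu - phi f <= a.
Proof.
split=> [mua f Df|mua]; last by apply: ge_ereal_sup => _ [f Df <-]; rewrite lee_fin mua.
by rewrite -lee_fin; apply: le_trans mua; apply: ereal_sup_ubound; exists f.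
Qed.

Lemma conjugate_level mu a :
  (conjugate Cb phi mu <= a%:E)%E -> level a (fun f => pairing f mu).
Proof.
move=> /conjugate_leP mua; split=> [c f g Cf Cg|f _|f Cf].
- rewrite -(pairingZ mu c (Cb_Bb Cf)) -pairingD//; last exact: Cb_Bb.
  exact: Cb_Bb (CbZ c Cf).
- exact: pairing_ge0.
- by rewrite -lerBlDr; exact: mua.
Qed.

Lemma level_norm a L f (M : R) : level a L -> Cb f -> (forall x, `|f x| <= M) ->
  `|L f| <= M * (a + phi (fun=> 1)).
Proof.
move=> [linL posL leL] Cf fM.
have C1 : Cb (fun _ : T => 1 : R) by exact: Cb_cst.
have M0 : 0 <= M by exact: le_trans (fM point).
apply: (@le_trans _ _ (M * L (fun=> 1))); last by rewrite ler_wpM2l// leL.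
have LM : L (fun=> M * 1) = M * L (fun=> 1) by rewrite (linear_CbZ linL M C1).
have LN : L (fun=> - M * 1) = - M * L (fun=> 1) by rewrite (linear_CbZ linL _ C1).
rewrite ler_norml -mulNr -LM -LN.
by apply/andP; split; apply: (positive_Cb_le linL posL) => //;
  rewrite ?mulr1; (exact: Cb_cst || move=> x; have := fM x; rewrite ler_norml; lra).
Qed.

Lemma level_ultra_lim a (F : set_system nat) (L_ : nat -> (T -> R) -> R) :
  UltraFilter F -> (forall n, level a (L_ n)) ->
  exists2 L, level a L & forall f, Cb f -> L_ n f @[n --> F] --> L f.
Proof.
move=> FU lev.
have cvgL f : exists l : R, Cb f -> L_ n f @[n --> F] --> l.
  have [Cf|] := pselect (Cb f); last by exists 0.
  have /bounded_existsP[M fM] := Cf.1.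
  have [l] := ultra_bounded_cvg FU (fun n => level_norm (lev n) Cf fM).
  by exists l.
have [L LP] := choice cvgL; exists L => //; split.
- move=> c f g Cf Cg.
  have Cfg : Cb (c *: (f : T -> R^o) + g) by exact: CbD (CbZ c Cf) Cg.
  have h := LP _ Cfg.
  have h' : L_ n (c *: (f : T -> R^o) + g) @[n --> F] --> c * L f + L g.
    rewrite (_ : (fun n => _) = fun n => c * L_ n f + L_ n g); last first.
      by apply/funext => n; rewrite (level_linear (lev n)).
    by apply: cvgD; [apply: cvgM; [exact: cvg_cst|exact: LP]|exact: LP].
  exact: (cvg_unique (@Rhausdorff R) h h').
- move=> f Cf f0; apply: (cvgr_to_ge (LP _ Cf)).
  by apply: nearW => n; exact: (level_ge0 (lev n)).
- move=> f Cf; apply: (cvgr_to_le (LP _ Cf)).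
  by apply: nearW => n; exact: (level_le (lev n)).
Qed.

(** Uniform tightness of the level turns approximation on compact sets into
    approximation of the values [L f], uniformly in [L]. *)
Lemma level_test_functions a : exists G : nat -> T -> R,
  (forall k, Cb (G k)) /\
  forall f e, Cb f -> (forall x, 0 <= f x) -> 0 < e ->
    exists k, forall L, level a L -> `|L f - L (G k)| <= e.
Proof.
have tight m : exists K : set T, compact K /\
    forall L h, level a L -> Cb h -> (forall x, 0 <= h x <= 1) ->
    (forall x, K x -> h x = 0) -> L h <= m.+1%:R^-1.
  have [|K cK KL] := @level_tight a m.+1%:R^-1; first by rewrite invr_gt0.
  by exists K.
have [K KP] := choice tight.
have [G [CG G0 GP]] := countable_dense_Cb (fun m => (KP m).1).
exists G; split=> // f e Cf f0 e0.
have /bounded_existsP[M fM] := Cf.1.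
have M0 : 0 <= M by exact: le_trans (fM point).
have M1 : 0 < M + 1 by lra.
pose B := `|a + phi (fun=> 1)| + 1.
have B0 : 0 < B by rewrite ltr_wpDl.
pose d := e / 2 / B.
have d0 : 0 < d by rewrite !divr_gt0.
pose m := Num.truncn ((M + 1) / (e / 2)).
have [k [Gf fG]] := GP f m d Cf f0 d0.
exists k => L La; have [linL posL leL] := La.
have C1 : Cb (fun _ : T => 1 : R) by exact: Cb_cst.
have Cd : Cb (fun x => `|f x - G k x|) by exact/Cb_norm/CbB.
pose h x := (M + 1)^-1 * Num.max 0 (`|f x - G k x| - d * 1).
have Ch : Cb h.
  apply: CbZ; apply: Cb_max; first exact: Cb_cst.
  by apply: CbB => //; exact: Cb_cst.
have hm : L h <= m.+1%:R^-1.
  apply: (KP m).2 => // [x|x Kx].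
    rewrite /h mulr_ge0 ?invr_ge0 ?(ltW M1) ?le_max ?lexx//=.
    rewrite mulrC ler_pdivrMr// mul1r ge_max (ltW M1)/=.
    suff : `|f x - G k x| <= M + d by lra.
    have := fM x; have := f0 x; have := G0 k x; have := Gf x.
    by rewrite !ler_norml; lra.
  rewrite /h (max_idPl _) ?mulr0// mulr1 subr_le0.
  by have := Gf x; have := fG x Kx; rewrite ler_norml; lra.
have Ld : L (fun x => `|f x - G k x|) <= e.
  apply: (@le_trans _ _ (L (fun x => d * 1 + (M + 1) * h x))).
    apply: (positive_Cb_le linL posL) => //; first by apply: CbD; apply: CbZ.
    move=> x; rewrite /h mulrA divff ?gt_eqF// mul1r -lerBlDl.
    by rewrite le_max lexx orbT.
  rewrite (linear_CbD linL (CbZ d C1) (CbZ (M + 1) Ch)).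
  rewrite (linear_CbZ linL d C1) (linear_CbZ linL _ Ch) [leRHS]splitr lerD//.
    apply: (@le_trans _ _ (d * B)); last by rewrite /d divfK// gt_eqF.
    rewrite ler_pM2l//; apply: (le_trans (leL _ C1)).
    by rewrite /B; have := ler_norm (a + phi (fun=> 1)); lra.
  apply: (@le_trans _ _ ((M + 1) * m.+1%:R^-1)); first by rewrite ler_pM2l.
  rewrite ler_pdivrMr// mulrC -ler_pdivrMr ?divr_gt0//.
  by rewrite ltW// truncnS_gt.
rewrite -(linear_CbB linL)//; apply: le_trans Ld.
have CfG := CbB Cf (CG k).
rewrite ler_norml; apply/andP; split; last first.
  by apply: (positive_Cb_le linL posL) => // x; exact: ler_norm.
rewrite -mulN1r -(linear_CbZ linL _ Cd).
apply: (positive_Cb_le linL posL) => //; first exact: CbZ.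
by move=> x; rewrite mulN1r lerNl -normrN ler_norm.
Qed.

(** Convergence along an ultrafilter gives a limit measure; a subsequence is
    then extracted by testing against the countable family only. *)
Lemma level_subsequence a (u : nat -> @ca_plus R T) :
  (forall n, (conjugate Cb phi (u n) <= a%:E)%E) ->
  exists2 s : nat -> nat, increasing_seq s & exists2 mu,
    (conjugate Cb phi mu <= a%:E)%E &
    forall f, Cb f -> pairing f (u (s j)) @[j --> \oo] --> pairing f mu.
Proof.
move=> ua; have ul n := conjugate_level (ua n).
have [F [FU Foo]] := ultraFilterLemma (@eventually_filter).
have [L La LP] := level_ultra_lim FU ul.
have [mu Lmu] := level_measure La.
have mua : (conjugate Cb phi mu <= a%:E)%E.
  apply/conjugate_leP => f Cf; rewrite -Lmu//.
  by have := level_le La Cf; lra.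
have [G [CG GP]] := level_test_functions a.
pose near_mu j n := forall i, (i < j)%N ->
  `|pairing (G i) mu - pairing (G i) (u n)| < j.+1%:R^-1.
have Fnear j : F (near_mu j).
  have : F [set n | forall i : 'I_j,
      `|pairing (G i) mu - pairing (G i) (u n)| < j.+1%:R^-1].
    apply: filter_forall => i.
    have /cvgrPdist_lt := LP _ (CG i); rewrite Lmu//.
    by apply; rewrite invr_gt0.
  by apply: filterS => n h i ij; exact: (h (Ordinal ij)).
have late (Nj : nat * nat) : exists n, (Nj.1 <= n)%N /\ near_mu Nj.2 n.
  case: Nj => N j; have : F ([set n | (N <= n)%N] `&` near_mu j).
    by apply: filterI => //; apply: Foo; exact: nbhs_infty_ge.
  by move=> /filter_ex[n [? ?]]; exists n.
have [c cP] := choice late.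
pose s := fix s j := if j is j'.+1 then c ((s j').+1, j) else c (0%N, 0%N).
have s_near j : near_mu j (s j) by case: j => [|j]; exact: (cP (_, _)).2.
exists s; first by apply/increasing_seqP => j; exact: (cP (_, _)).1.
exists mu => //.
have mul := conjugate_level mua.
have cvgG i : pairing (G i) (u (s j)) @[j --> \oo] --> pairing (G i) mu.
  apply/cvgrPdist_le => e e0; near=> j.
  have ij : (i < j)%N by near: j; exact: nbhs_infty_gt.
  apply: ltW; apply: lt_le_trans (s_near j i ij) _.
  rewrite invf_ple ?posrE//.
  have : (Num.truncn e^-1 <= j)%N by near: j; exact: nbhs_infty_ge.
  rewrite -(ler_nat R) => je; rewrite -natr1.
  by have := truncnS_gt e^-1; rewrite -natr1; lra.
have cvg0 f : Cb f -> (forall x, 0 <= f x) ->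
    pairing f (u (s j)) @[j --> \oo] --> pairing f mu.
  move=> Cf f0; apply/cvgrPdist_le => e e0.
  have e3 : 0 < e / 3 by rewrite divr_gt0.
  have [k kP] := GP f _ Cf f0 e3.
  have /cvgrPdist_le/(_ _ e3) := cvgG k.
  apply: filterS => j; have := kP _ mul; have := kP _ (ul (s j)).
  by rewrite !ler_norml; lra.
move=> f Cf; have /bounded_existsP[M fM] := Cf.1.
have CM : Cb (fun _ : T => M) by exact: Cb_cst.
have CfM := CbD Cf CM.
have f0 x : 0 <= f x + M by have := fM x; rewrite ler_norml; lra.
have M0 (x : T) : 0 <= M by exact: le_trans (fM x).
have pE nu : pairing f nu = pairing (fun x => f x + M) nu - pairing (fun=> M) nu.
  by rewrite pairingD ?addrK//; exact: Cb_Bb.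
rewrite pE (_ : (fun j => _) = fun j => pairing (fun x => f x + M) (u (s j)) -
  pairing (fun=> M) (u (s j))); last by apply/funext => j.
by apply: cvgB; exact: cvg0.
Unshelve. all: by end_near. Qed.

Lemma level_set_sequentially_compact a :
  sequentially_compact ([set mu | (conjugate Cb phi mu <= a%:E)%E]
    : set (sigma_ca_Cb T)).
Proof.
move=> u ua; have [s incs [mu mua cvgs]] := level_subsequence ua.
exists s => //; exists mu => //.
apply/cvg_sup => -[f Cf] A; rewrite nbhsE.
move=> [_ [[W oW <-] Wmu] BA].
apply: (filterS BA).
have := cvgs _ Cf W; apply.
exact: open_nbhs_nbhs (conj oW Wmu).
Qed.

End levels.

(** * Duality on a pseudometric space *)

Section duality.
Context {R : realType} {T : pseudoPMetricType R}.
Variable phi : (T -> R) -> R.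
Hypothesis phi_increasing : forall f g, Bb f -> Bb g ->
  (forall x, g x <= f x) -> phi g <= phi f.
Hypothesis phi_tight : forall m e : R, 0 < m -> 0 < e ->
  exists K : set T, [/\ compact K, closed K &
    phi (fun x => m * \1_(~` K) x) <= e].
Hypothesis phi_convex : convex_function (E := (T -> R^o)) Bb phi.
Implicit Types (f g : T -> R) (mu : @ca_plus R T).

(** A subgradient of [phi] at [f] over [Cb] is positive because [phi] is
    increasing, and it belongs to the level [q f - phi f], hence is a measure. *)
Lemma Cb_maximizer f : Cb f -> exists mu : @ca_plus R T,
  forall g, Cb g -> pairing g mu - phi g <= pairing f mu - phi f.
Proof.
move=> Cf.
have [t x y t01 Cx Cy|q linq qphi] :=
    @convex_subgradient R (T -> R^o) Cb subspace_Cb phi f Cf.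
  have /andP[t0 t1] := t01.
  have := @phi_convex (Itv01 t0 t1) x y.
  by rewrite !inE; apply; exact: Cb_Bb.
have q_ge0 h : Cb h -> (forall x, 0 <= h x) -> 0 <= q h.
  move=> Ch h0; have := qphi _ (CbN Ch).
  have -> : q (fun x => - h x) = - q h.
    rewrite -mulN1r -(linear_CbZ linq _ Ch); congr q.
    by apply/funext => x; rewrite mulN1r.
  have : phi (fun x => f x - h x) <= phi f.
    apply: phi_increasing => [||x]; [exact: Cb_Bb|exact/Cb_Bb/CbB|].
    by rewrite gerBl.
  rewrite -[phi (f \+ _)]/(phi (fun x => f x - h x)); lra.
have lev : level phi (q f - phi f) q.
  split=> // g Cg; have := qphi _ (CbB Cg Cf).
  rewrite (linear_CbB linq Cg Cf).
  have -> : ((f : T -> R^o) + (fun x => g x - f x)) = g.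
    by apply/funext => x /=; rewrite /GRing.add/= subrKC.
  lra.
have [mu qmu] := level_measure phi_increasing phi_tight lev.
exists mu => g Cg; rewrite -!qmu//.
by have := level_le lev Cg; lra.
Qed.

(** Maximizers for the [f_ j] have uniformly bounded mass, hence lie in one
    level set; for a limit point [mu], [pairing f mu - conjugate Cb phi mu] is at
    least the limit [l] of [phi (f_ j)]. *)
Lemma decreasing_limit_maximizer f (f_ : nat -> T -> R) :
  Bb f -> (forall j, Cb (f_ j)) ->
  (forall x, decreases_to (fun j => f_ j x) (f x)) ->
  exists2 l : R, decreases_to (fun j => phi (f_ j)) l & phi f <= l /\
    exists mu, (conjugate Cb phi mu <= (pairing f mu - l)%:E)%E.
Proof.
move=> Bf Cf_ ff_.
have f_dec i j x : (i <= j)%N -> f_ j x <= f_ i x by exact: (ff_ x).1.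
have f_ge j x : f x <= f_ j x by exact: (decreases_to_ge j (ff_ x)).
have phi_ge j : phi f <= phi (f_ j) by apply: phi_increasing => //; exact: Cb_Bb.
have phi_dec : nonincreasing_seq (fun j => phi (f_ j)).
  move=> i j ij; apply: phi_increasing => [||x]; [exact: Cb_Bb|exact: Cb_Bb|].
  exact: f_dec.
pose l := inf (range (fun j => phi (f_ j))).
have has_lb : has_lbound (range (fun j => phi (f_ j))).
  by exists (phi f) => _ [j _ <-].
have l_le j : l <= phi (f_ j) by apply: ge_inf => //; exists j.
exists l; first by split=> //; exact: nonincreasing_cvgn.
split.
  by apply: lb_le_inf; [exists (phi (f_ 0%N)), 0%N|move=> _ [j _ <-]].
have [mu muP] := choice (fun j => Cb_maximizer (Cf_ j)).
have /bounded_existsP[M fM] := (Cf_ 0%N).1.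
have C1 : Cb (fun _ : T => 1 : R) by exact: Cb_cst.
have pM (c : R) j : pairing (fun=> c) (mu j) = c * pairing (fun=> 1) (mu j).
  by rewrite !pairing_cst mul1r.
have CM (c : R) : Cb (fun _ : T => c) by exact: Cb_cst.
have pf j : pairing (f_ j) (mu j) <= M * pairing (fun=> 1) (mu j).
  rewrite -pM; apply: le_pairing; [exact: Cb_Bb|exact: Cb_Bb|move=> x].
  by have := fM x; have := f_dec _ _ x (leq0n j); rewrite ler_norml; lra.
(* test the maximality of f_ j against the constant M + 1 *)
have mass j : pairing (fun=> 1) (mu j) <= phi (fun=> M + 1) - phi f.
  have := muP j _ (CM (M + 1)); rewrite (pM (M + 1) j).
  by have := pf j; have := phi_ge j; lra.
have M0 : 0 <= M by exact: le_trans (fM point).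
pose a := M * (phi (fun=> M + 1) - phi f) - phi f.
have mua j : (conjugate Cb phi (mu j) <= a%:E)%E.
  apply/conjugate_leP => g Cg; apply: (le_trans (muP j _ Cg)).
  apply: lerB => //; apply: (le_trans (pf j)).
  by rewrite ler_wpM2l.
have [s incs [nu nua cvgs]] := level_subsequence phi_increasing phi_tight mua.
have s_ge j : (j <= s j)%N.
  by elim: j => // j; move/leq_ltn_trans; apply; exact: (increasing_seqP s).2.
exists nu; apply/conjugate_leP => g Cg.
have step k : pairing g nu - phi g <= pairing (f_ k) nu - l.
  apply: (@ler_cvg_to _ \oo _ R (fun j => pairing g (mu (s j)) - phi g)
    (fun j => pairing (f_ k) (mu (s j)) - l)).
  - by apply: cvgB; [apply: cvgs|exact: cvg_cst].
  - by apply: cvgB; [apply: cvgs|exact: cvg_cst].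
  near=> j; apply: (le_trans (muP (s j) _ Cg)).
  apply: lerB; last exact: l_le.
  apply: le_pairing => [||x]; [exact: Cb_Bb|exact: Cb_Bb|].
  apply: f_dec.
  have : (k <= j)%N by near: j; exact: nbhs_infty_ge.
  by move=> /leq_trans; apply; exact: s_ge.
apply: (@cvgr_to_ge _ \oo _ R (fun k => pairing (f_ k) nu - l)); last exact: nearW.
apply: cvgB; last exact: cvg_cst.
by apply: pairing_decr_cvg => // j; exact: Cb_Bb.
Unshelve. all: by end_near. Qed.

(** The maximum formula gives [l <= phi f] at the limit point [mu] above, which is
    continuity along decreasing sequences, and this applied to an approximating
    sequence gives regularity from above. The latter lets a test function in [Ub]
    be replaced by one in [Cb], whence equal conjugates. These in turn give
    [pairing f mu - conjugate Cb phi mu <= phi f <= l], so that [mu] attains. *)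
Lemma duality_equivalences :
  [<->
    forall f, Ub f ->
      is_max [set ((pairing f mu)%:E - conjugate Cb phi mu)%E
             | mu in [set: @ca_plus R T]] (phi f)%:E;
    forall f, Ub f -> forall f_ : nat -> T -> R,
      (forall j, Cb (f_ j)) ->
      (forall x, decreases_to (fun j => f_ j x) (f x)) ->
      decreases_to (fun j => phi (f_ j)) (phi f);
    forall f, Ub f ->
      (phi f)%:E = ereal_inf [set (phi g)%:E
        | g in [set g | Cb g /\ forall x, f x <= g x]];
    forall mu : @ca_plus R T,
      conjugate Cb phi mu = conjugate Ub phi mu ].
Proof.
tfae.
- move=> maxU f Uf f_ Cf_ ff_.
  have [l dl [fl [mu mul]]] := decreasing_limit_maximizer (Ub_Bb Uf) Cf_ ff_.
  suff -> : phi f = l by [].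
  apply/eqP; rewrite eq_le fl/= -lee_fin.
  have /(_ ((pairing f mu)%:E - conjugate Cb phi mu)%E) := (maxU f Uf).2.
  move=> /(_ (ex_intro2 _ _ mu I erefl)); apply: le_trans.
  have -> : l = pairing f mu - (pairing f mu - l) by lra.
  by rewrite EFinB leeB.
- move=> cont f Uf; apply/eqP; rewrite eq_le; apply/andP; split.
    apply: le_ereal_inf_tmp => _ [g [Cg fg] <-]; rewrite lee_fin.
    by apply: phi_increasing => //; [exact: Cb_Bb|exact: Ub_Bb].
  have [f_ [Cf_ ff_]] := Ub_approx Uf.
  have [_ cv] := cont f Uf f_ Cf_ ff_.
  apply/lee_addgt0Pr => e e0; rewrite -EFinD.
  have /cvgrPdist_le/(_ _ e0)[j _ /(_ j (leqnn j))/=] := cv.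
  rewrite ler_norml => fj; apply: (@le_trans _ _ (phi (f_ j))%:E); last first.
    by rewrite lee_fin; lra.
  apply: ereal_inf_lbound; exists (f_ j) => //; split=> // x.
  exact: (decreases_to_ge j (ff_ x)).
- move=> reg mu; apply/eqP; rewrite eq_le; apply/andP; split.
    apply: le_ereal_sup => _ [f Cf <-]; exists f => //; exact: Cb_Ub.
  apply: ge_ereal_sup => _ [f Uf <-].
  apply/lee_addgt0Pr => e e0.
  have [|_ [g [Cg fg] <-]] := @lb_ereal_inf_adherent R
      [set (phi g)%:E | g in [set g | Cb g /\ forall x, f x <= g x]] e e0.
    by rewrite -reg.
  rewrite -reg// -EFinD lte_fin => phig.
  apply: (@le_trans _ _ ((pairing g mu - phi g)%:E + e%:E)%E).
    rewrite -EFinD lee_fin.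
    by have := le_pairing mu (Ub_Bb Uf) (Cb_Bb Cg) fg; lra.
  by rewrite leeD2r//; apply: ereal_sup_ubound; exists g.
- move=> conjE f Uf.
  have conj_ge mu : ((pairing f mu - phi f)%:E <= conjugate Cb phi mu)%E.
    by rewrite conjE; apply: ereal_sup_ubound; exists f.
  split; last first.
    move=> _ [mu _ <-].
    have -> : phi f = pairing f mu - (pairing f mu - phi f) by lra.
    by rewrite [leRHS]EFinB leeB.
  have [f_ [Cf_ ff_]] := Ub_approx Uf.
  have [l _ [fl [mu mul]]] := decreasing_limit_maximizer (Ub_Bb Uf) Cf_ ff_.
  exists mu => //.
  have -> : conjugate Cb phi mu = (pairing f mu - phi f)%:E.
    apply/eqP; rewrite eq_le conj_ge andbT (le_trans mul)// lee_fin; lra.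
  by rewrite -EFinB; congr EFin; lra.
Qed.

End duality.

(** * Countable products *)

(* Joins the product pseudometric with the base point of the product. *)
HB.instance Definition _ (R : realType) (I : countType)
    (X : I -> pseudoPMetricType R) := Pointed.on (prod_topology X).

Lemma esum_geometric_le {R : realType} (I : countType) (e : R) : 0 <= e ->
  (\esum_(i in [set: I]) (e / (2 ^ (pickle i).+1)%:R)%:E <= e%:E)%E.
Proof.
move=> e0; pose b (n : nat) : \bar R := (e / (2 ^ n.+1)%:R)%:E.
have b0 n : (0 <= b n)%E by rewrite lee_fin divr_ge0.
have inj : set_inj [set: I] pickle by move=> i j _ _; exact: (pcan_inj pickleK).
rewrite -(esum_image [set: I] pickle b inj).
apply: le_trans (epsilon_trick0 xpredT e0); rewrite nneseries_esumT//.
rewrite esum_mkcond; apply: le_esum => n _.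
by case: ifP => // _; exact: b0.
Qed.

Section product.
Context {R : realType} {I : countType} (X : I -> pmetricType R).
Variable phi_ : forall i, (X i -> R) -> R.
Arguments phi_ : clear implicits.
Variable phi : (prod_topology X -> R) -> R.
Hypothesis phi_tight : forall i (m eps : R), 0 < m -> 0 < eps ->
  exists2 K : set (X i), compact K & phi_ i (fun x => m * \1_(~` K) x) <= eps.
Hypothesis phi_le : forall f (g : forall i, X i -> R),
  Bb f -> (forall i, Bb_plus (g i)) ->
  (forall x, ((f x)%:E <= oplus g x)%E) ->
  ((phi f)%:E <= \esum_(i in [set: I]) (phi_ i (g i))%:E)%E.

(** A point outside the box of the [K i] is outside [K i] in some coordinate, so
    the indicators of the complements are comparable with [oplus]; the budgets
    of the coordinates form a geometric series. *)
Lemma product_tight (m e : R) : 0 < m -> 0 < e ->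
  exists K : set (prod_topology X), [/\ compact K, closed K &
    phi (fun x => m * \1_(~` K) x) <= e].
Proof.
move=> m0 e0.
pose d i := e / (2 ^ (pickle (i : I)).+1)%:R.
have d0 i : 0 < d i by rewrite divr_gt0// ltr0n expn_gt0.
have tight i : exists K : set (X i),
    compact K /\ phi_ i (fun x => m * \1_(~` K) x) <= d i.
  by have [K cK phiK] := phi_tight i m0 (d0 i); exists K.
pose K i := projT1 (cid (tight i)).
have KP i : compact (K i) /\ phi_ i (fun x => m * \1_(~` K i) x) <= d i.
  exact: projT2 (cid (tight i)).
have clK i : closed (K i).
  by apply: compact_closed (KP i).1; exact: (@metric_hausdorff R (X i)).
pose P : set (prod_topology X) := [set x | forall i, K i (x i)].
have cP : compact P by apply: tychonoff => i; exact: (KP i).1.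
have clP : closed P.
  by apply: compact_closed cP; apply: hausdorff_product => i; exact: metric_hausdorff.
have ind_ge0 (S : Type) (A : set S) x : 0 <= m * \1_A x :> R.
  by rewrite mulr_ge0 ?(ltW m0)// indicE ler0n.
exists P; split=> //; rewrite -lee_fin.
apply: le_trans (esum_geometric_le I (ltW e0)).
apply: (@le_trans _ _ (\esum_(i in [set: I])
    (phi_ i (fun x => m * \1_(~` K i) x))%:E)%E); last first.
  by apply: le_esum => i _; rewrite lee_fin; exact: (KP i).2.
apply: (phi_le (g := fun i x => m * \1_(~` K i) x)) => [|i|x].
- by apply: Bb_indic; apply: measurable_open; exact: closed_openC.
- split; last exact: ind_ge0.
  by apply: Bb_indic; apply: measurable_open; exact: closed_openC (clK i).
- rewrite /oplus; have [Px|nPx] := pselect (P x).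
    rewrite indicE memNset ?mulr0; last by move=> /(_ Px).
    by apply: esum_ge0 => i _; rewrite lee_fin.
  have /existsNP[i nKi] := nPx.
  apply: (@le_trans _ _ (\esum_(j in [set i]) (m * \1_(~` K j) (x j))%:E)%E).
    by rewrite esum_set1 ?lee_fin// !indicE !mem_set.
  rewrite esum_mkcond; apply: le_esum => j _.
  by case: ifP => // _; rewrite lee_fin.
Qed.

End product.

Theorem theorem2p2 (R : realType) (I : countType) (X : I -> pmetricType R)
  (phi_ : forall i, (X i -> R) -> R)
  (phi : (prod_topology X -> R) -> R)
  (phi_ge0 : forall i (g : X i -> R), Bb_plus g -> 0 <= phi_ i g)
  (phi_tight : forall i (m eps : R), 0 < m -> 0 < eps ->
    exists2 K : set (X i), compact K &
      phi_ i (fun x => m * \1_(~` K) x) <= eps)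
  (phi_increasing : forall f g, Bb f -> Bb g ->
    (forall x, g x <= f x) -> phi g <= phi f)
  (phi_convex :
    convex_function (E := (prod_topology X -> R^o)) Bb phi)
  (phi_le : forall f (g : forall i, X i -> R),
    Bb f -> (forall i, Bb_plus (g i)) ->
    (forall x, ((f x)%:E <= oplus g x)%E) ->
    ((phi f)%:E <= \esum_(i in [set: I]) (phi_ i (g i))%:E)%E) :
  (forall a : R,
    sequentially_compact
      ([set mu | (conjugate Cb phi mu <= a%:E)%E]
        : set (sigma_ca_Cb (prod_topology X))))
  /\
  [<->
    forall f, Ub f ->
      is_max [set ((pairing f mu)%:E - conjugate Cb phi mu)%E
             | mu in [set: ca_plus (prod_topology X)]] (phi f)%:E;
    forall f, Ub f -> forall f_ : nat -> prod_topology X -> R,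
      (forall j, Cb (f_ j)) ->
      (forall x, decreases_to (fun j => f_ j x) (f x)) ->
      decreases_to (fun j => phi (f_ j)) (phi f);
    forall f, Ub f ->
      (phi f)%:E = ereal_inf [set (phi g)%:E
        | g in [set g | Cb g /\ forall x, f x <= g x]];
    forall mu : ca_plus (prod_topology X),
      conjugate Cb phi mu = conjugate Ub phi mu ].
Proof.
have tight := product_tight phi_tight phi_le.
split=> [a|]; last exact: (duality_equivalences phi_increasing tight phi_convex).
exact: (level_set_sequentially_compact phi_increasing tight).
Qed.
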